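(* Let $n \in \mathbb{N}$, $n \geq 3$, be arbitrary. Let $\mathcal{OD}_{n}$ be the monoid of order-preserving and order-reversing transformations on $\{1,\ldots,n\}$ with the usual order, and let $\gamma_{n}$ be the permutation of degree $n$ that reverses this order. Then the maximal subsemigroups of $\mathcal{OD}_{n}$ are precisely: (a) $\mathcal{OD}_{n} \setminus \{\gamma_{n}\}$ (type (M5)); (b) the union of $\mathcal{OD}_{n} \setminus J_{n - 1}$ and the union of the sets in $$\{(L_{(i + 1) / 2} \cup L_{n + 1 - (i + 1) / 2}) \cap \mathcal{OD}_{n} : i \in A,\ i\ \text{is odd}\} \cup \{(R_{\{ i / 2, (i / 2) + 1\}} \cup R_{\{ n - (i / 2), n + 1 - (i / 2) \}}) \cap \mathcal{OD}_{n} : i \in A,\ i\ \text{is even}\},$$ where $A$ is a maximal independent subset of the path graph of order $n$ that contains both odd and even numbers (type (M2)); (c) $\mathcal{OD}_{n} \setminus (L_{i} \cup L_{n -i + 1})$, where $i \in \{1, \ldots, (n + 1) / 2\}$ if $n$ is odd, and $i \in \{1, \ldots, n / 2 - 1\}$ if $n$ is even (type (M3)); and (d) $\mathcal{OD}_{n}\setminus (R_{\{i, i + 1\}} \cup R_{\{n -i, n -i + 1\}})$, where $i \in \{2, \ldots, (n - 3) / 2\}$ if $n$ is odd, and $i \in \{2, \ldots, n / 2\}$ if $n$ is even (type (M4)). In particular, there are $3$ maximal subsemigroups of $\mathcal{OD}_{3}$, and for $n \geq 4$, there are $A_{n} + n - 3$ maximal subsemigroups of $\mathcal{OD}_{n}$,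 where $A_{1} = 1$, $A_{2} = A_{3} = 2$, and $A_{n} = A_{n - 2} + A_{n - 3}$ for $n \geq 4$. The monoid $\mathcal{OD}_{2} = \mathcal{T}_{2}$ has $2$ maximal subsemigroups.
   Context: $\mathbb{N}=\{1,2,3,\ldots\}$. A maximal subsemigroup of a semigroup $S$ is a proper subsemigroup not contained in any other proper subsemigroup of $S$. $\mathcal{PT}_n$ is the monoid of all partial maps from $\{1,\ldots,n\}$ to itself under composition (maps written on the right), and $\mathcal{T}_n$ is its submonoid of transformations (elements with domain $\{1,\ldots,n\}$). A transformation $\alpha$ is order-preserving if $1\alpha\le\cdots\le n\alpha$ and order-reversing if $1\alpha\ge\cdots\ge n\alpha$. $i\gamma_n=n-i+1$ for all $i$. $\operatorname{rank}(\alpha)=|\operatorname{im}(\alpha)|$ and $\ker(\alpha)=\{(i,j): i\alpha=j\alpha\}$ on $\operatorname{dom}(\alpha)$. Define $J_{n-1}=\{\alpha\in\mathcal{PT}_n:\operatorname{rank}(\alpha)=n-1\}$ and, for distinct $i,j$: $L_i=\{\alpha\in J_{n-1}: i\notin\operatorname{im}(\alpha)\}$, $R_{\{i,j\}}=\{\alpha\in J_{n-1}:(i,j)\in\ker(\alpha)\}$. The $\mathscr{L}$-classes of $J_{n-1}\cap\mathcal{OD}_n$ are the sets $L_i\cap\mathcal{OD}_n$ and its $\mathscr{R}$-classes are the sets $R_{\{i,i+1\}}\cap\mathcal{OD}_n$. The path graph of order $k$ has vertices $\{1,\ldots,k\}$ and edges $\{i,i+1\}$ for $1\le i\le k-1$.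 An independent subset of a graph is a set of vertices no two of which are adjacent; it is maximal if it is contained in no other independent subset. Types: a maximal subsemigroup $M$ of a finite monoid $S$ arises from the $\mathscr{J}$-class $J$ if $S\setminus M\subseteq J$; when $J$ is regular, $M$ has type (M1) if $M\cap J=\varnothing$; (M2) if $M\cap J$ is a non-empty union of both $\mathscr{L}$- and $\mathscr{R}$-classes of $J$ (those in a non-empty proper subset of the $\mathscr{L}$-classes together with those in a non-empty proper subset of the $\mathscr{R}$-classes); (M3) if $M\cap J$ is a non-empty union of $\mathscr{L}$-classes; (M4) if $M\cap J$ is a non-empty union of $\mathscr{R}$-classes; (M5) if $M\cap J$ meets every $\mathscr{H}$-class of $J$. *)

(* Defs.v *)
From HB Require Import structures.
From mathcomp Require Import all_boot.
Set Implicit Arguments.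
Unset Strict Implicit.
Unset Printing Implicit Defensive.

#[short(type="finMonoidType")]
HB.structure Definition FinMonoid := {G of Monoid G & Finite G}.

(** Subsemigroups and Green's relations of a submonoid [S] of a finite monoid.
    Since [S] has an identity, the principal ideals S^1 a, a S^1, S^1 a S^1
    are S a, a S, S a S. *)
Section Semigroups.
Local Open Scope group_scope.
Variables (T : finMonoidType) (S : {set T}).
Implicit Types (a b : T) (J M : {set T}).

(* The empty set qualifies; this never affects the maximal subsemigroups of a
   finite semigroup with at least two elements, since that contains an
   idempotent, hence a nonempty proper subsemigroup. *)
Definition subsemigroup M := [forall a in M, forall b in M, a * b \in M].

Definition proper_subsemigroup M := (M \proper S) && subsemigroup M.

Definition maximal_subsemigroup M := maxset proper_subsemigroup M.

Definition maximal_subsemigroups := [set M | maximal_subsemigroup M].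

Definition lideal a := [set s * a | s in S].
Definition rideal a := [set a * s | s in S].
Definition ideal a := [set s * a * t | s in S, t in S].

Definition greenL a b := lideal a == lideal b.
Definition greenR a b := rideal a == rideal b.
Definition greenH a b := greenL a b && greenR a b.
Definition greenJ a b := ideal a == ideal b.

Definition green_class (g : rel T) a := [set b in S | g a b].
Definition green_classes (g : rel T) (B : {set T}) :=
  [set green_class g a | a in B].

Definition regular J := [forall a in J, [exists s in S, a * s * a == a]].

Definition arises_from M J := S :\: M \subset J.

(* The types are meant for a maximal subsemigroup [M] of [S]; then S \ M is
   nonempty and determines [J]. *)
Definition has_type (P : {set T} -> {set T} -> Prop) M :=
  exists J, [/\ J \in green_classes greenJ S, regular J, arises_from M J & P J M].

Definition M2_in J M := exists X Y : {set {set T}},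
  [/\ X != set0 /\ X \proper green_classes greenL J,
      Y != set0 /\ Y \proper green_classes greenR J &
      M :&: J = cover X :|: cover Y].

Definition M3_in J M := M :&: J != set0 /\
  exists2 X : {set {set T}}, X \subset green_classes greenL J & M :&: J = cover X.

Definition M4_in J M := M :&: J != set0 /\
  exists2 Y : {set {set T}}, Y \subset green_classes greenR J & M :&: J = cover Y.

Definition M5_in J M :=
  forall H : {set T}, H \in green_classes greenH J -> M :&: H != set0.

Definition type_M2 := has_type M2_in.
Definition type_M3 := has_type M3_in.
Definition type_M4 := has_type M4_in.
Definition type_M5 := has_type M5_in.

End Semigroups.

(** The monoid of partial maps of {1, ..., n}, the point [x : 'I_n] standing for
    the number [num x]; maps act on the right, so [a * b] is [a] followed by
    [b]. *)
Definition num n (x : 'I_n) : nat := x.+1.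

Definition PT (n : nat) := {ffun 'I_n -> option 'I_n}.
HB.instance Definition _ n := Finite.copy (PT n) {ffun 'I_n -> option 'I_n}.

Section PartialMaps.
Variable n : nat.

Definition PT_mul (a b : PT n) : PT n := [ffun x => obind b (a x)].
Definition PT_one : PT n := [ffun x => Some x].

Fact PT_mulA : associative PT_mul.
Proof. by move=> a b c; apply/ffunP=> x; rewrite !ffunE; case: (a x) => //= y; rewrite ffunE. Qed.
Fact PT_mul1 : left_id PT_one PT_mul.
Proof. by move=> a; apply/ffunP=> x; rewrite !ffunE. Qed.
Fact PT_mulr1 : right_id PT_one PT_mul.
Proof. by move=> a; apply/ffunP=> x; rewrite !ffunE; case: (a x) => //= y; rewrite ffunE. Qed.

HB.instance Definition _ := isMonoid.Build (PT n) PT_mulA PT_mul1 PT_mulr1.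

Implicit Types a : PT n.

Definition dom a := [set x | a x != None].
Definition im a := [set y | [exists x, a x == Some y]].
Definition rank a := #|im a|.
Definition ker a :=
  [set p : 'I_n * 'I_n | [&& p.1 \in dom a, p.2 \in dom a & a p.1 == a p.2]].

Definition full_transf := [set a | dom a == setT].

Definition order_preserving a := [forall x : 'I_n, forall y : 'I_n, forall u : 'I_n, forall v : 'I_n,
  [&& x <= y, a x == Some u & a y == Some v] ==> (u <= v)].
Definition order_reversing a := [forall x : 'I_n, forall y : 'I_n, forall u : 'I_n, forall v : 'I_n,
  [&& x <= y, a x == Some u & a y == Some v] ==> (v <= u)].

Definition OD :=
  [set a in full_transf | order_preserving a || order_reversing a].

Definition gamma : PT n := [ffun x => Some (rev_ord x)].

Definition Jpred := [set a | rank a == n.-1].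

(* The indices are the numbers 1, ..., n; out of range these sets are empty. *)
Definition Lset (i : nat) :=
  [set a in Jpred | [exists x, (num x == i) && (x \notin im a)]].
Definition Rset (i j : nat) :=
  [set a in Jpred | [exists x, exists y,
     [&& num x == i, num y == j & (x, y) \in ker a]]].

Definition path_graph : rel 'I_n :=
  fun x y => (num y == (num x).+1) || (num x == (num y).+1).

End PartialMaps.

Definition independent (V : finType) (e : rel V) (A : {set V}) :=
  [forall x in A, forall y in A, ~~ e x y].

Definition maximal_independent (V : finType) (e : rel V) (A : {set V}) :=
  maxset (independent e) A.

(* The sequence is indexed from 1; the value at 0 is not used. *)
Fixpoint Aseq (n : nat) : nat :=
  match n with
  | 0 => 0
  | 1 => 1
  | 2 => 2
  | 3 => 2
  | ((k.+1 as k1).+1 as k2).+2 => Aseq k2 + Aseq k1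
  end.

Lemma AseqE n : 4 <= n -> Aseq n = Aseq (n - 2) + Aseq (n - 3).
Proof. by case: n => [|[|[|[|k]]]] // _; rewrite !subSS !subn0. Qed.

Lemma order_preservingP n (a : PT n) :
  reflect (forall x y u v : 'I_n,
             x <= y -> a x = Some u -> a y = Some v -> u <= v)
          (order_preserving a).
Proof.
apply: (iffP forallP) => [H x y u v xy ax ay | H x].
  move/forallP/(_ y)/forallP/(_ u)/forallP/(_ v): (H x).
  by rewrite xy ax ay !eqxx.
apply/forallP=> y; apply/forallP=> u; apply/forallP=> v; apply/implyP.
by case/and3P=> xy /eqP ax /eqP ay; apply: (H x y).
Qed.

Lemma order_reversingP n (a : PT n) :
  reflect (forall x y u v : 'I_n,
             x <= y -> a x = Some u -> a y = Some v -> v <= u)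
          (order_reversing a).
Proof.
apply: (iffP forallP) => [H x y u v xy ax ay | H x].
  move/forallP/(_ y)/forallP/(_ u)/forallP/(_ v): (H x).
  by rewrite xy ax ay !eqxx.
apply/forallP=> y; apply/forallP=> u; apply/forallP=> v; apply/implyP.
by case/and3P=> xy /eqP ax /eqP ay; apply: (H x y).
Qed.

Lemma full_transfP n (a : PT n) :
  reflect (forall x, exists y, a x = Some y) (a \in full_transf n).
Proof.
rewrite inE; apply: (iffP eqP) => [H x | H].
  have: x \in dom a by rewrite H inE.
  by rewrite inE; case: (a x) => // y _; exists y.
by apply/setP=> x; rewrite !inE; case: (H x) => y ->.
Qed.

Lemma OD_monoid_closed n : monoid_closed (OD n).
Proof.
split=> [|a b].
  rewrite inE; apply/andP; split.
    by apply/full_transfP=> x; exists x; rewrite ffunE.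
  by apply/orP; left; apply/order_preservingP=> x y u v xy; rewrite !ffunE => -[<-] [<-].
rewrite ![_ \in OD n]inE => /andP[/full_transfP fa Ha] /andP[/full_transfP fb Hb].
apply/andP; split.
  apply/full_transfP=> x; case: (fa x) => y ay; case: (fb y) => z bz.
  by exists z; rewrite ffunE ay.
have E x u : (a * b)%g x = Some u -> exists2 y, a x = Some y & b y = Some u.
  by rewrite ffunE; case: (a x) => //= y by_; exists y.
case/orP: Ha => [/order_preservingP Ha|/order_reversingP Ha];
case/orP: Hb => [/order_preservingP Hb|/order_reversingP Hb].
- apply/orP; left; apply/order_preservingP=> x y u v xy /E[p ap bp] /E[q aq bq].
  exact: Hb (Ha _ _ _ _ xy ap aq) bp bq.
- apply/orP; right; apply/order_reversingP=> x y u v xy /E[p ap bp] /E[q aq bq].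
  exact: Hb (Ha _ _ _ _ xy ap aq) bp bq.
- apply/orP; right; apply/order_reversingP=> x y u v xy /E[p ap bp] /E[q aq bq].
  exact: Hb (Ha _ _ _ _ xy ap aq) bq bp.
- apply/orP; left; apply/order_preservingP=> x y u v xy /E[p ap bp] /E[q aq bq].
  exact: Hb (Ha _ _ _ _ xy ap aq) bq bp.
Qed.

Definition set_a n := OD n :\ gamma n.

Definition set_b n (A : {set 'I_n}) :=
  (OD n :\: Jpred n) :|:
  ((\bigcup_(x in A | odd (num x))
      ((Lset n ((num x + 1) %/ 2) :|: Lset n (n + 1 - (num x + 1) %/ 2))
        :&: OD n)) :|:
   (\bigcup_(x in A | ~~ odd (num x))
      ((Rset n (num x %/ 2) (num x %/ 2 + 1) :|:
        Rset n (n - num x %/ 2) (n + 1 - num x %/ 2)) :&: OD n))).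

Definition index_b n (A : {set 'I_n}) :=
  [/\ maximal_independent (@path_graph n) A,
      exists2 x, x \in A & odd (num x) & exists2 x, x \in A & ~~ odd (num x)].

Definition set_c n (i : nat) := OD n :\: (Lset n i :|: Lset n (n - i + 1)).

Definition index_c (n i : nat) :=
  if odd n then 1 <= i <= (n + 1) %/ 2 else 1 <= i <= n %/ 2 - 1.

Definition set_d n (i : nat) :=
  OD n :\: (Rset n i (i + 1) :|: Rset n (n - i) (n - i + 1)).

Definition index_d (n i : nat) :=
  if odd n then 2 <= i <= (n - 3) %/ 2 else 2 <= i <= n %/ 2.

(* Main.v *)
Require Import Defs.
From mathcomp Require Import all_boot.
From mathcomp Require Import zify.
Set Implicit Arguments.
Unset Strict Implicit.
Unset Printing Implicit Defensive.

(** Let J be the set of elements of rank n - 1. An element of J is given by the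
    pair {k, k+1} that its kernel identifies, the point i that its image misses,
    and its orientation. The product of (k, i, s) and (l, j, t) is (k, j, st) if i
    is l or l+1, and has smaller rank otherwise; the units are 1 and gamma, and
    gamma reflects k or i and reverses the orientation ([corank1_mul],
    [corank1_mul_J], [corank1_flip], [flip_corank1]). The monoid is generated by
    gamma and J ([OD_gen]).

    A maximal subsemigroup without gamma is the complement of gamma. One that
    contains gamma contains all elements outside J, and its intersection with J is
    invariant under gamma on both sides. Place points and kernel pairs alternately
    on a path, so that i is adjacent to the pairs {i-1, i} and {i, i+1}; folding
    this path by the reflection gives the path graph of order n, with the points
    at the odd numbers and the kernel pairs at the even ones. A set A of vertices
    determines the set M_A of elements outside J together with those of J that
    have one of their two vertices in A; in all of (b), (c) and (d) the
    subsemigroup is of this form. If A is independent then M_A is a subsemigroup,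
    proper if A omits an odd and an even number ([set_b_subsemigroup],
    [set_b_proper]); and every proper subsemigroup that contains gamma lies in
    such an M_A ([cover_subsemigroup], a reachability argument). As inclusion of
    the M_A is inclusion of the A ([set_b_subset]), the maximal subsemigroups
    that contain gamma correspond to the maximal ones among these A
    ([maximal_subsemigroupE]).

    Such a maximal A is either a maximal independent set with numbers of both
    parities, or one parity class without a vertex v that is not adjacent to an
    end of the path ([maxset_admissibleP]). This gives (b), and (c) and (d)
    according to the parity of v. Counting, there are A_n - 2 sets of the first
    kind, since the two parity classes are the other maximal independent sets, and
    for n >= 4 there are n - 2 admitted vertices v. The types follow because the
    L-classes and R-classes in J are given by the missed point and the kernel. *)

(** * Order-preserving and order-reversing transformations *)

(** The transformation with values given by [f]. *)
Definition tot n (f : 'I_n -> 'I_n) : PT n := [ffun x => Some (f x)].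

(** The two units of the monoid: [gamma n] for [true], the identity for [false].
    A boolean [s] records throughout whether an element reverses the order. *)
Definition flip n (s : bool) : PT n := if s then gamma n else 1%g.

(** Order-preservation of a total function. *)
Definition monotone n (f : 'I_n -> 'I_n) := forall x y : 'I_n, x <= y -> f x <= f y.

Section Total.
Variable n : nat.
Implicit Types (f g : 'I_n -> 'I_n) (a b : PT n).

Lemma tot_mul f g : (tot f * tot g)%g = tot (g \o f).
Proof. by apply/ffunP=> x; rewrite !ffunE /= ffunE. Qed.

Lemma eq_tot f g : f =1 g -> tot f = tot g.
Proof. by move=> fg; apply/ffunP=> x; rewrite !ffunE fg. Qed.

Lemma tot_inj f g : tot f = tot g -> f =1 g.
Proof. by move=> /ffunP fg x; move: (fg x); rewrite !ffunE => -[]. Qed.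

Lemma tot1 : tot id = 1%g :> PT n.
Proof. by apply/ffunP=> x; rewrite !ffunE. Qed.

Lemma tot_gamma : tot (@rev_ord n) = gamma n.
Proof. by []. Qed.

Lemma totP a : a \in full_transf n -> exists f, a = tot f.
Proof.
move/full_transfP=> fa.
exists (fun x => odflt x (a x)); apply/ffunP=> x; rewrite ffunE.
by case: (fa x) => y ->.
Qed.

Lemma im_tot f : im (tot f) = f @: setT.
Proof.
apply/setP=> y; rewrite inE; apply/existsP/imsetP => [[x]|[x _ ->]].
  by rewrite ffunE => /eqP[<-]; exists x.
by exists x; rewrite ffunE.
Qed.

Lemma ker_tot f x y : ((x, y) \in ker (tot f)) = (f x == f y).
Proof. by rewrite !inE !ffunE /=. Qed.

Lemma gammaK : (gamma n * gamma n)%g = 1%g.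
Proof.
by rewrite -tot_gamma tot_mul -tot1; apply: eq_tot => x; apply: rev_ordK.
Qed.

Lemma flipM s t : (flip n s * flip n t)%g = flip n (s (+) t).
Proof. by case: s t => [] []; rewrite /flip /= ?gammaK ?mulg1 ?mul1g. Qed.

Lemma flip_full s : flip n s = tot (if s then @rev_ord n else id).
Proof. by case: s; rewrite /= ?tot1. Qed.

Lemma OD_tot f : (tot f \in OD n) =
  [forall x : 'I_n, forall y : 'I_n, (x <= y) ==> (f x <= f y)]
  || [forall x : 'I_n, forall y : 'I_n, (x <= y) ==> (f y <= f x)].
Proof.
rewrite inE; have -> /= : tot f \in full_transf n.
  by apply/full_transfP=> x; exists (f x); rewrite ffunE.
congr (_ || _).
  apply/order_preservingP/'forall_'forall_implyP => [H x y xy|H x y u v xy].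
    by apply: (H x y); rewrite ?ffunE.
  by rewrite !ffunE => -[<-] [<-]; apply: H.
apply/order_reversingP/'forall_'forall_implyP => [H x y xy|H x y u v xy].
  by apply: (H x y); rewrite ?ffunE.
by rewrite !ffunE => -[<-] [<-]; apply: H.
Qed.

Lemma OD_mul a b : a \in OD n -> b \in OD n -> (a * b)%g \in OD n.
Proof. by case: (OD_monoid_closed n) => _; apply. Qed.

Lemma OD_1 : 1%g \in OD n.
Proof. by case: (OD_monoid_closed n). Qed.

Lemma OD_gamma : gamma n \in OD n.
Proof.
rewrite -tot_gamma OD_tot; apply/orP; right.
by apply/'forall_'forall_implyP=> x y; rewrite /=; lia.
Qed.

Lemma OD_flip s : flip n s \in OD n.
Proof. by case: s; rewrite ?OD_1 ?OD_gamma. Qed.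

Lemma ODP a : reflect
  (exists s, exists2 f, monotone f & a = (tot f * flip n s)%g)
  (a \in OD n).
Proof.
apply: (iffP idP) => [aO|[s [f fm ->]]].
  have [f E] : exists f, a = tot f by apply: totP; move: aO; rewrite inE => /andP[].
  move: aO; rewrite {a}E OD_tot => /orP[] /'forall_'forall_implyP fm.
    by exists false; exists f; rewrite ?mulg1.
  exists true; exists (fun x => rev_ord (f x)).
    by move=> x y xy; move: (fm x y xy) (ltn_ord (f x)) (ltn_ord (f y)) => /=; lia.
  rewrite /flip -tot_gamma tot_mul; apply: eq_tot => x /=; by rewrite rev_ordK.
apply: OD_mul; last exact: OD_flip.
by rewrite OD_tot; apply/orP; left; apply/'forall_'forall_implyP.
Qed.

Lemma rank_tot f : rank (tot f) = #|f @: setT|.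
Proof. by rewrite /rank im_tot. Qed.

Lemma rank_mulr a b : rank (a * b)%g <= rank b.
Proof.
apply/subset_leq_card/subsetP=> y; rewrite !inE => /existsP[x].
rewrite ffunE; case: (a x) => //= z bz; apply/existsP; by exists z.
Qed.

Lemma rank_mull a b : rank (a * b)%g <= rank a.
Proof.
rewrite {1}/rank.
have -> : #|im (a * b)%g| = #|Some @: im (a * b)%g|.
  by rewrite card_imset //; exact: Some_inj.
have S : Some @: im (a * b)%g \subset b @: im a.
  apply/subsetP=> _ /imsetP[y + ->]; rewrite !inE => /existsP[x].
  rewrite ffunE; case E: (a x) => [z|] //= /eqP <-.
  by apply: imset_f; rewrite inE; apply/existsP; exists x; rewrite E.
by apply: leq_trans (subset_leq_card S) (leq_imset_card _ _).
Qed.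

Lemma rank_le a : rank a <= n.
Proof. by rewrite -[X in _ <= X]card_ord; apply: max_card. Qed.

Lemma rank_flip a s : rank (a * flip n s)%g = rank a.
Proof.
apply/eqP; rewrite eqn_leq rank_mull /=.
by rewrite -{1}[a]mulg1 -[1%g]/(flip n false) -(addbb s) -flipM mulgA rank_mull.
Qed.

Lemma rank1 : rank (1%g : PT n) = n.
Proof. by rewrite -tot1 rank_tot imset_id cardsT card_ord. Qed.

Lemma rank_gamma : rank (gamma n) = n.
Proof. by rewrite -[gamma n]mul1g -[gamma n]/(flip n true) rank_flip rank1. Qed.

(** The only order-preserving permutation of a finite chain is the identity, so
    the units of OD are the identity and [gamma n]. *)
Lemma mono_inj_id f : monotone f -> injective f -> f =1 id.
Proof.
move=> fm fi.
have fs (x y : 'I_n) : x < y -> f x < f y.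
  move=> xy; move: (fm x y (ltnW xy)); rewrite leq_eqVlt => /orP[/eqP/val_inj/fi E|//].
  by move: xy; rewrite E ltnn.
have lo k (x : 'I_n) : x = k :> nat -> k <= f x.
  elim: k x => // k IH x xk.
  have kn : k < n by move: (ltn_ord x); lia.
  have lt1 := IH (Ordinal kn) erefl.
  by apply: leq_ltn_trans lt1 (fs _ _ _); rewrite /= xk.
have hi k (x : 'I_n) : n - x = k -> f x + k <= n.
  elim: k x => [|k IH] x xk; first by rewrite addn0 ltnW.
  have [E|xn] := eqVneq x.+1 n; first by move: (ltn_ord (f x)); lia.
  have x1n : x.+1 < n by move: (ltn_ord x); lia.
  have H := IH (Ordinal x1n); have := fs x (Ordinal x1n) (ltnSn _).
  by move: H => /=; move: (ltn_ord x); lia.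
move=> x; apply: val_inj => /=.
by move: (lo x x erefl) (hi _ x erefl) (ltn_ord x); lia.
Qed.

Lemma rank_full_flip a : a \in OD n -> rank a = n -> exists s, a = flip n s.
Proof.
case/ODP=> s [f fm ->]; rewrite rank_flip rank_tot => E.
have fi : injective f.
  have: #|f @: setT| == #|[set: 'I_n]| by rewrite E cardsT card_ord.
  by move/imset_injP => H x y; apply: H; rewrite inE.
exists s; rewrite (eq_tot (mono_inj_id fm fi)) tot1 mul1g //.
Qed.
End Total.

(** * The elements of rank n - 1 *)

Section Corank1.
Variable m : nat.
Local Notation n := m.+2.
Implicit Types (a b : PT n) (i j : 'I_n) (k l : 'I_m.+1) (s t : bool).

Fact collapse_subproof k i : unbump k i < m.+1.
Proof. by move: (ltn_ord k) (ltn_ord i); rewrite /unbump; lia. Qed.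

(** The order-preserving surjection of n points onto n - 1 points that
    identifies the points [k] and [k + 1]. *)
Definition collapse k i : 'I_m.+1 := Ordinal (collapse_subproof k i).

(** The order-preserving map of rank n - 1 whose kernel identifies [k] and
    [k + 1] and whose image misses [i]. *)
Definition alpha k i : PT n := tot (fun x => lift i (collapse k x)).

(** The complement of the point [i] is a transversal of the kernel that
    identifies [k] and [k + 1]. *)
Definition transv i k := (i == k :> nat) || (i == k.+1 :> nat).

(** Reversal of ['I_d] when [s] holds. *)
Definition revb d s (x : 'I_d) := if s then rev_ord x else x.

(** The element of rank n - 1 with kernel pair [k], [k + 1] and missed point [i],
    order-reversing exactly when [s] holds. Since [gamma] moves the missed point
    of what precedes it, the first factor must miss the reversal of [i] when [s]
    holds. *)
Definition corank1 k i s : PT n := (alpha k (revb s i) * flip n s)%g.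

Lemma alpha_flip k i s : (alpha k i * flip n s)%g = corank1 k (revb s i) s.
Proof. by rewrite /corank1; case: s; rewrite /= ?rev_ordK. Qed.

Lemma flip_alpha k i s :
  (flip n s * alpha k i)%g = (alpha (revb s k) (revb s i) * flip n s)%g.
Proof.
case: s => //=; last by rewrite mul1g mulg1.
rewrite -tot_gamma /alpha !tot_mul; apply: eq_tot => x; apply: val_inj => /=.
move: (ltn_ord k) (ltn_ord i) (ltn_ord x).
by rewrite /bump /unbump /=; lia.
Qed.

Lemma collapse_lift l i z : transv i l -> collapse l (lift i z) = z.
Proof.
move=> H; apply: val_inj => /=; move: H (ltn_ord z).
by rewrite /transv /bump /unbump /=; lia.
Qed.

Lemma alpha_mul k i l j : transv i l -> (alpha k i * alpha l j)%g = alpha k j.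
Proof.
move=> H; rewrite tot_mul; apply: eq_tot => x /=.
by rewrite collapse_lift.
Qed.

Lemma revb_transv s i l : transv (revb s i) (revb s l) = transv i l.
Proof.
by case: s => //=; rewrite /transv /=; move: (ltn_ord i) (ltn_ord l); lia.
Qed.

Lemma revbD d s t (x : 'I_d) : revb s (revb t x) = revb (s (+) t) x.
Proof. by case: s t => [] [] //=; rewrite rev_ordK. Qed.

Lemma corank1_mul k i s l j t : transv i l ->
  (corank1 k i s * corank1 l j t)%g = corank1 k j (s (+) t).
Proof.
move=> il; rewrite /corank1 mulgA -(mulgA (alpha _ _)) flip_alpha.
by rewrite mulgA alpha_mul ?revb_transv // -mulgA flipM revbD.
Qed.

Lemma corank1_flip k i s t : (corank1 k i s * flip n t)%g = corank1 k (revb t i) (s (+) t).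
Proof. by rewrite /corank1 -mulgA flipM revbD -addbA addbb addbF. Qed.

Lemma flip_corank1 k i s t : (flip n t * corank1 k i s)%g = corank1 (revb t k) i (s (+) t).
Proof. by rewrite /corank1 mulgA flip_alpha -mulgA flipM revbD addbC. Qed.

Lemma collapse_surj k z : exists x, collapse k x = z.
Proof.
exists (lift (lift ord_max k) z); apply: val_inj; rewrite /= /bump /unbump /=.
by move: (ltn_ord k) (ltn_ord z); lia.
Qed.

Lemma alpha_mono k i : monotone (fun x => lift i (collapse k x)).
Proof. by move=> x y xy; rewrite /= leq_bump2 /unbump; lia. Qed.

Lemma corank1_OD k i s : corank1 k i s \in OD n.
Proof.
apply/ODP; exists s, (fun x => lift (revb s i) (collapse k x)) => //.
exact: alpha_mono.
Qed.

Lemma im_alpha k i : im (alpha k i) = [set~ i].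
Proof.
rewrite im_tot; apply/setP=> y; rewrite !inE.
apply/imsetP/idP => [[x _ ->]|]; first by rewrite eq_sym neq_lift.
rewrite eq_sym => /unlift_some[z -> _].
by case: (collapse_surj k z) => x <-; exists x.
Qed.

Lemma corank1_fun k i s : corank1 k i s = tot (fun x => revb s (lift (revb s i) (collapse k x))).
Proof.
rewrite /corank1 flip_full tot_mul; apply: eq_tot => x /=; by case: s.
Qed.

Lemma revb_inj d s : injective (@revb d s).
Proof. by move=> x y /(congr1 (revb s)); rewrite !revbD addbb. Qed.

Lemma im_corank1 k i s : im (corank1 k i s) = [set~ i].
Proof.
rewrite corank1_fun im_tot (imset_comp (@revb n s) (fun x : 'I_n => lift (revb s i) (collapse k x))).
rewrite -im_tot -/(alpha k (revb s i)) im_alpha; apply/setP=> y; rewrite !inE.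
apply/imsetP/idP => [[x +->]|yi].
  by rewrite !inE; apply: contraNneq => <-; rewrite revbD addbb.
exists (revb s y); last by rewrite revbD addbb.
by rewrite !inE (inj_eq (@revb_inj _ s)).
Qed.

Lemma corank1_J k i s : corank1 k i s \in Jpred n.
Proof. by rewrite inE /rank im_corank1 cardsC1 card_ord. Qed.

Lemma ker_corank1 k i s x y :
  ((x, y) \in ker (corank1 k i s)) = (collapse k x == collapse k y).
Proof.
by rewrite corank1_fun ker_tot (inj_eq (@revb_inj _ s)) (inj_eq lift_inj).
Qed.

(** An order-preserving map that is not injective factors as an element of rank
    n - 1 followed by an order-preserving map of rank one more: if [k] and
    [k + 1] have the same value and [y] is not a value, separate the two points
    by a new point, inserted where the value [y] keeps the map monotone. *)
Lemma raise_rank f : monotone f -> ~ injective f ->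
  exists k i, exists2 g, monotone g &
    tot f = (alpha k i * tot g)%g /\ rank (tot g) = (rank (tot f)).+1.
Proof.
move=> fm fni.
have [k Ek] : exists k : 'I_m.+1, f (inord k) = f (inord k.+1).
  suff /existsP[k /eqP] : [exists k : 'I_m.+1, f (inord k) == f (inord k.+1)].
    by exists k.
  apply: contra_notT fni; rewrite negb_exists => /forallP H.
  have fs d (x y : 'I_n) : x + d.+1 = y -> f x < f y.
    elim: d y => [|d IH] y xy.
      have xm : x < m.+1 by move: (ltn_ord y); lia.
      have := H (Ordinal xm); have -> : inord (Ordinal xm) = x by apply: val_inj; rewrite /= inordK.
      have -> : inord (Ordinal xm).+1 = y :> 'I_n.
        by apply: val_inj; rewrite /= inordK /=; move: (ltn_ord y); lia.
      have: f x <= f y by apply: fm; lia.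
      rewrite leq_eqVlt => /orP[/eqP/val_inj->|//]; by rewrite eqxx.
    have yn : y.-1 < n by move: (ltn_ord y); lia.
    have := IH (Ordinal yn); have: f (Ordinal yn) <= f y by apply: fm => /=; lia.
    move=> H1 H2; have xy' : x + d.+1 = Ordinal yn by rewrite /=; lia.
    exact: leq_trans (H2 xy') H1.
  move=> x y E; apply: val_inj => /=; case: (ltngtP x y) => // xy.
    have xy' : x + (y - x.+1).+1 = y by lia.
    by move: (fs _ _ _ xy'); rewrite E ltnn.
  have xy' : y + (x - y.+1).+1 = x by lia.
  by move: (fs _ _ _ xy'); rewrite E ltnn.
have [y Hy] : exists y, y \notin f @: setT.
  apply/existsP; apply: contra_notT fni; rewrite negb_exists => /forallP H.
  have: #|f @: setT| == #|[set: 'I_n]|.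
    rewrite (_ : f @: setT = setT) //; apply/setP=> y; rewrite inE.
    by move: (H y); rewrite negbK.
  by move/imset_injP => fi u v; apply: fi; rewrite inE.
pose F (z : 'I_m.+1) := f (lift (inord k) z).
have Fm (z z' : 'I_m.+1) : z <= z' -> F z <= F z'.
  by move=> zz; apply: fm; rewrite /= leq_bump2.
have FE x : F (collapse k x) = f x.
  rewrite /F; have [E|xk] := eqVneq (x : nat) k.
    have -> : x = inord k by apply: val_inj; rewrite /= inordK //; move: (ltn_ord k); lia.
    rewrite Ek; congr f; apply: val_inj.
    rewrite /= !inordK /bump /unbump; move: (ltn_ord k); lia.
  congr f; apply: val_inj; rewrite /= inordK; last by move: (ltn_ord k); lia.
  by rewrite unbumpK // inE.
have Fy z : F z != y.
  by apply: contraNneq Hy => <-; apply: imset_f.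
(* The new point has exactly the points with values below y on its left. *)
have [p pn pP] : exists2 p, p < n & forall z : 'I_m.+1, (z < p) = (F z < y).
  pose Q p := [forall z : 'I_m.+1, (F z < y) ==> (z < p)].
  have exQ : exists p, Q p.
    by exists m.+1; apply/forallP=> z; rewrite ltn_ord implybT.
  case: (ex_minnP exQ) => p /forallP Qp minp; exists p.
    by apply: minp; apply/forallP=> z; rewrite ltn_ord implybT.
  move=> z; apply/idP/idP => [zp|]; last exact: implyP.
  rewrite ltnNge; apply: contraL zp => yz; rewrite -leqNgt.
  apply: minp; apply/forallP=> z'; apply/implyP=> z'y.
  by rewrite ltnNge; apply: contraL z'y => zz; rewrite -leqNgt (leq_trans yz) ?Fm.
pose i := Ordinal pn.
pose g x := if unlift i x is Some z then F z else y.
exists k, i, g.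
  move=> u v; rewrite /g; case: unliftP => [z ->|->]; case: unliftP => [w ->|->] //=.
  - by rewrite leq_bump2 => /Fm.
  - move=> zp; apply: ltnW; rewrite -pP; move: zp; rewrite /bump /=; lia.
  - move=> zp; rewrite leqNgt -pP -leqNgt; move: zp; rewrite /bump /=; lia.
split.
  rewrite tot_mul; apply: eq_tot => x /=.
  by rewrite /g liftK FE.
rewrite !rank_tot; have -> : g @: setT = y |: f @: setT.
  apply/setP=> v; rewrite !inE; apply/imsetP/orP => [[x _ ->]|[/eqP->|/imsetP[x _ ->]]].
  - rewrite /g; case: unliftP => [z _|_]; last by left.
    by right; apply: imset_f.
  - by exists i => //; rewrite /g unlift_none.
  - exists (lift i (collapse k x)) => //; by rewrite /g liftK FE.
by rewrite cardsU1 Hy.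
Qed.

End Corank1.

Section Structure.
Variable m : nat.
Local Notation n := m.+2.
Implicit Types (a b : PT n) (i j : 'I_n) (k l : 'I_m.+1) (s t : bool).

Lemma rank_inj (f : 'I_n -> 'I_n) : rank (tot f) = n <-> injective f.
Proof.
rewrite rank_tot; split=> [E|fi]; last by rewrite card_imset // cardsT card_ord.
have: #|f @: setT| == #|[set: 'I_n]| by rewrite E cardsT card_ord.
by move/imset_injP => H x y; apply: H; rewrite inE.
Qed.

Lemma J_corank1 a : a \in OD n -> a \in Jpred n -> exists k i s, a = corank1 k i s.
Proof.
case/ODP=> s [f fm ->]; rewrite inE rank_flip => /eqP /= rf.
have fni : ~ injective f by move=> /(rank_inj f).2; rewrite rf; lia.
have [k [i [g gm [E rg]]]] := raise_rank fm fni.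
have gi : injective g by apply/rank_inj; rewrite rg rf.
exists k, (revb s i), s.
by rewrite E (eq_tot (mono_inj_id gm gi)) tot1 mulg1 alpha_flip.
Qed.

Lemma OD_cases a : a \in OD n ->
  [\/ exists s, a = flip n s, exists k i s, a = corank1 k i s | rank a <= m].
Proof.
move=> aO; case: (ltngtP (rank a) m.+1) => [lo|hi|E].
- by constructor 3.
- constructor 1; apply: rank_full_flip => //.
  by move: (rank_le a); lia.
- by constructor 2; apply: J_corank1 => //; rewrite inE E.
Qed.

(** The monoid is generated by [gamma n] and the elements of rank n - 1. *)
Lemma OD_gen (M : {set PT n}) : (forall a b, a \in M -> b \in M -> (a * b)%g \in M) ->
  gamma n \in M -> (forall k i s, corank1 k i s \in M) -> OD n \subset M.
Proof.
move=> Mm Mg Me; have Mf s : flip n s \in M.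
  by case: s => //=; rewrite -gammaK Mm.
apply/subsetP=> _ /ODP[s [f fm ->]]; apply: (Mm) => //.
move: {-1}(n - rank (tot f)) (leqnn (n - rank (tot f))) => d.
elim: d f fm => [|d IH] f fm le_d.
  have fi : injective f by apply/rank_inj; move: (rank_le (tot f)); lia.
  by rewrite (eq_tot (mono_inj_id fm fi)) tot1 -[1%g]/(flip n false).
have [/rank_inj fi|/eqP ne] := eqVneq (rank (tot f)) n.
  by rewrite (eq_tot (mono_inj_id fm fi)) tot1 -[1%g]/(flip n false).
have fni : ~ injective f by move=> /(rank_inj f).2.
have [k [i [g gm [E rg]]]] := raise_rank fm fni.
rewrite E; apply: (Mm); last by apply: (IH) => //; move: (rank_le (tot g)); lia.
by rewrite -[alpha k i]mulg1 -[1%g]/(flip n false) alpha_flip.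
Qed.

(** The product of two elements of rank n - 1 again has rank n - 1 exactly when
    the image of the first is a transversal of the kernel of the second. *)
Lemma corank1_mul_J k i s l j t :
  ((corank1 k i s * corank1 l j t)%g \in Jpred n) = transv i l.
Proof.
apply/idP/idP => [|il]; last by rewrite corank1_mul // corank1_J.
apply: contraTT => nil; rewrite inE /= neq_ltn; apply/orP; left; rewrite ltnS.
have [h Eh] : exists h, corank1 l j t = tot h by eexists; apply: corank1_fun.
have hl : h (inord l) = h (inord l.+1).
  apply/eqP; rewrite -ker_tot -Eh ker_corank1; apply/eqP/val_inj.
  by rewrite /= /unbump !inordK; move: (ltn_ord l); lia.
rewrite {1}corank1_fun Eh tot_mul rank_tot imset_comp -im_tot -corank1_fun im_corank1.
(* Both l and l + 1 are in the image of the first factor, so one is redundant. *)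
have -> : h @: [set~ i] = h @: ([set~ i] :\ inord l).
  apply/setP=> y; apply/imsetP/imsetP => -[x]; last first.
    by rewrite !inE => /andP[_ xi] ->; exists x; rewrite // !inE.
  move=> xi ->; have [->|xl] := eqVneq x (inord l); last by exists x; rewrite // in_setD1 xl.
  exists (inord l.+1) => //; rewrite !inE -!val_eqE /= !inordK;
    move: nil; rewrite /transv; move: (ltn_ord l); lia.
apply: leq_trans (leq_imset_card _ _) _.
have := cardsD1 (inord l) [set~ i]; rewrite cardsC1 card_ord /= !inE.
have -> : (inord l != i) = true; last by lia.
by rewrite -val_eqE /= inordK; move: nil; rewrite /transv; move: (ltn_ord l); lia.
Qed.

Lemma corank1_Lset k i s q : (corank1 k i s \in Lset n q) = (i.+1 == q).
Proof.
rewrite inE corank1_J /=; apply/existsP/eqP => [[x /andP[/eqP <-]]|<-].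
  by rewrite im_corank1 !inE negbK => /eqP ->.
by exists i; rewrite eqxx im_corank1 !inE eqxx.
Qed.

Lemma corank1_Rset k i s q : (corank1 k i s \in Rset n q q.+1) = (k.+1 == q).
Proof.
rewrite inE corank1_J /=; apply/existsP/eqP => [[x /existsP[y /and3P[/eqP ? /eqP E2]]]|<-].
  rewrite ker_corank1 -val_eqE /= /unbump; move: E2; subst q; rewrite /num; lia.
exists (inord k); apply/existsP; exists (inord k.+1).
rewrite ker_corank1 -val_eqE /= /unbump /num !inordK ?ltn_ord //; move: (ltn_ord k); lia.
Qed.

Fact missv_subproof i : minn i.*2 (m.+1 - i).*2 < n.
Proof. move: (ltn_ord i); lia. Qed.
(** Vertices of the path graph are counted from 0 here, so those with an odd
    number are the even ones. The points and the kernel pairs alternate along a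
    path with 2n - 1 vertices, [i] at position [2 i] and the pair [k], [k + 1] at
    position [2 k + 1]; the action of [gamma] reflects this path, and the quotient
    by the reflection is the path of order n. [missv i] is the vertex of the
    missed point [i]. *)
Definition missv i : 'I_n := Ordinal (missv_subproof i).
Fact kerv_subproof k : minn k.*2.+1 (m - k).*2.+1 < n.
Proof. move: (ltn_ord k); lia. Qed.
(** The vertex of the kernel pair [k], [k + 1]. *)
Definition kerv k : 'I_n := Ordinal (kerv_subproof k).

Lemma missv_even i : odd (missv i) = false.
Proof. rewrite /=; lia. Qed.
Lemma kerv_odd k : odd (kerv k).
Proof. rewrite /=; lia. Qed.

Lemma missv_surj (x : 'I_n) : ~~ odd x -> exists i, x = missv i.
Proof.
move=> ox; have ltx : x./2 < n by move: (ltn_ord x); lia.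
exists (Ordinal ltx); apply: val_inj; move: (ltn_ord x) => /=; lia.
Qed.

Lemma kerv_surj (x : 'I_n) : odd x -> exists k, x = kerv k.
Proof.
move=> ox; have ltx : x./2 < m.+1 by move: (ltn_ord x); lia.
exists (Ordinal ltx); apply: val_inj; move: (ltn_ord x) => /=; lia.
Qed.

Lemma missv_eq i j : missv i = missv j -> exists s, i = revb s j.
Proof.
move=> /(congr1 val) /= E; move: (ltn_ord i) (ltn_ord j) => li lj.
have [ij|ij] := eqVneq i j; first by exists false.
exists true; apply: val_inj => /=; move/eqP: ij => ij.
have {}ij : i <> j :> nat by move/val_inj.
lia.
Qed.

Lemma kerv_eq k l : kerv k = kerv l -> exists s, k = revb s l.
Proof.
move=> /(congr1 val) /= E; move: (ltn_ord k) (ltn_ord l) => li lj.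
have [ij|ij] := eqVneq k l; first by exists false.
exists true; apply: val_inj => /=; move/eqP: ij => ij.
have {}ij : k <> l :> nat by move/val_inj.
lia.
Qed.

Lemma kerv_revb s k : kerv (revb s k) = kerv k.
Proof. by apply: val_inj; case: s => //=; move: (ltn_ord k); lia. Qed.

Lemma missv_revb s i : missv (revb s i) = missv i.
Proof. by apply: val_inj; case: s => //=; move: (ltn_ord i); lia. Qed.

Lemma transv_path i k : transv i k -> path_graph (missv i) (kerv k).
Proof.
by rewrite /transv /path_graph /num /=; move: (ltn_ord k) (ltn_ord i); lia.
Qed.

(** Adjacent vertices lift to a transversal pair after a reflection. *)
Lemma path_transv i k : path_graph (missv i) (kerv k) -> exists s, transv (revb s i) k.
Proof.
move=> H; case E: (transv i k); first by exists false.
exists true; move: H E; rewrite /transv /path_graph /num /=.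
by move: (ltn_ord k) (ltn_ord i); lia.
Qed.

(** For every set [A] of vertices, [set_b A] contains an element of rank n - 1
    exactly when [A] contains one of its two vertices. *)
Lemma corank1_set_b A k i s :
  (corank1 k i s \in set_b A) = (kerv k \in A) || (missv i \in A).
Proof.
rewrite /set_b !(in_setU, in_setD) corank1_J /= orbC; congr (_ || _).
  apply/bigcupP/idP => [[x /andP[xA xo]]|kA].
    rewrite in_setI in_setU; have [k' Ek'] : exists k', x = kerv k'.
      by apply: kerv_surj; move: xo; rewrite /num /= negbK.
    have -> : num x %/ 2 + 1 = (num x %/ 2).+1 by lia.
    have -> : n + 1 - num x %/ 2 = (n - num x %/ 2).+1.
      by move: (ltn_ord x); rewrite /num; lia.
    rewrite !corank1_Rset => /andP[H _]; rewrite (_ : kerv k = x) //.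
    by apply: val_inj => /=; move: (ltn_ord x) (ltn_ord k) H xo; rewrite /num /=; lia.
  exists (kerv k); first by rewrite kA /= negbK kerv_odd.
  rewrite in_setI corank1_OD andbT in_setU.
  have -> : num (kerv k) %/ 2 + 1 = (num (kerv k) %/ 2).+1 by lia.
  have -> : n + 1 - num (kerv k) %/ 2 = (n - num (kerv k) %/ 2).+1.
    by move: (ltn_ord (kerv k)); rewrite /num; lia.
  rewrite !corank1_Rset /num /=; move: (ltn_ord k); lia.
apply/bigcupP/idP => [[x /andP[xA xo]]|iA].
  rewrite in_setI in_setU !corank1_Lset => /andP[H _]; rewrite (_ : missv i = x) //.
  by apply: val_inj => /=; move: (ltn_ord x) (ltn_ord i) H xo; rewrite /num /=; lia.
exists (missv i); first by rewrite iA /= missv_even.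
rewrite in_setI corank1_OD andbT in_setU !corank1_Lset /num /=; move: (ltn_ord i); lia.
Qed.

Lemma notJ_set_b A a : a \in OD n -> a \notin Jpred n -> a \in set_b A.
Proof. by move=> aO aJ; rewrite /set_b in_setU in_setD aO aJ. Qed.

Lemma set_b_OD (A : {set 'I_n}) : set_b A \subset OD n.
Proof.
rewrite /set_b !subUset subsetDl /=; apply/andP; split.
  by apply/bigcupsP=> x _; apply: subsetIr.
by apply/bigcupsP=> x _; apply: subsetIr.
Qed.

Lemma flip_notJ s : flip n s \notin Jpred n.
Proof.
rewrite inE (_ : rank _ = n) /= ?neq_ltn ?leqnn ?orbT //.
by rewrite -[flip n s]mul1g rank_flip rank1.
Qed.
End Structure.

(** * Maximal subsemigroups and admissible sets of vertices *)

(** An independent set of vertices that omits a vertex of each parity: the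
    condition for [set_b A] to be a proper subsemigroup. *)
Definition admissible n (A : {set 'I_n}) :=
  [&& independent (@path_graph n) A, [exists x : 'I_n, odd x && (x \notin A)]
    & [exists x : 'I_n, ~~ odd x && (x \notin A)]].

Lemma independentP (V : finType) (e : rel V) (A : {set V}) :
  reflect {in A &, forall x y, ~~ e x y} (independent e A).
Proof.
apply: (iffP 'forall_implyP) => [H x y xA|H x xA].
  by move/'forall_implyP: (H x xA); apply.
by apply/'forall_implyP=> y; apply: H.
Qed.

Lemma subsemigroupP (T : finMonoidType) (M : {set T}) :
  reflect (forall a b, a \in M -> b \in M -> (a * b)%g \in M) (subsemigroup M).
Proof.
apply: (iffP 'forall_implyP) => [H a b aM|H a aM].
  by move/'forall_implyP: (H a aM); apply.
by apply/'forall_implyP=> b; apply: H.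
Qed.

Lemma path_graph_sym n : symmetric (@path_graph n).
Proof. by move=> x y; rewrite /path_graph orbC. Qed.

Lemma path_graph_irr n : irreflexive (@path_graph n).
Proof. by move=> x; rewrite /path_graph; lia. Qed.

Section Maximal.
Variable m : nat.
Local Notation n := m.+2.
Implicit Types (a b : PT n) (i j : 'I_n) (k l : 'I_m.+1) (s t : bool).
Implicit Types (M N : {set PT n}) (A B : {set 'I_n}).

Lemma admissibleP A : reflect
  [/\ independent (@path_graph n) A, exists k, kerv k \notin A
    & exists i, missv i \notin A] (admissible A).
Proof.
apply: (iffP and3P) => -[indA].
  case/existsP=> x /andP[/kerv_surj[k ->] kA] /existsP[y /andP[/missv_surj[i ->] iA]].
  by split=> //; [exists k|exists i].
case=> k kA [i iA]; split=> //; apply/existsP; last first.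
  by exists (missv i); rewrite iA missv_even.
by exists (kerv k); rewrite kA kerv_odd.
Qed.

Lemma set_b_subsemigroup A : independent (@path_graph n) A -> subsemigroup (set_b A).
Proof.
move/independentP => indA; apply/subsemigroupP => a b aA bA.
have aO := subsetP (set_b_OD A) a aA; have bO := subsetP (set_b_OD A) b bA.
have abO := OD_mul aO bO.
case: (OD_cases aO) => [[s Ea]|[k [i [s Ea]]]|ra]; last first.
- apply: notJ_set_b => //; rewrite inE neq_ltn ltnS /=.
  by rewrite (leq_trans (rank_mull _ _)).
- case: (OD_cases bO) => [[t Eb]|[l [j [t Eb]]]|rb]; last first.
  + apply: notJ_set_b => //; rewrite inE neq_ltn ltnS /=.
    by rewrite (leq_trans (rank_mulr _ _)).
  + have [J|] := boolP ((a * b)%g \in Jpred n); last exact: notJ_set_b.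
    move: J aA bA; rewrite Ea Eb corank1_mul_J => il; rewrite corank1_mul // !corank1_set_b.
    case: (kerv k \in A) => //= iA /orP[lA|//].
    by move: (indA _ _ iA lA); rewrite (transv_path il).
  + by move: aA; rewrite Ea Eb corank1_flip !corank1_set_b missv_revb.
- case: (OD_cases bO) => [[t Eb]|[l [j [t Eb]]]|rb].
  + by rewrite notJ_set_b // Ea Eb flipM flip_notJ.
  + by move: bA; rewrite Ea Eb flip_corank1 !corank1_set_b kerv_revb.
  + apply: notJ_set_b => //; rewrite inE neq_ltn ltnS /=.
    by rewrite (leq_trans (rank_mulr _ _)).
Qed.

Lemma set_b_proper A : admissible A -> proper_subsemigroup (OD n) (set_b A).
Proof.
case/admissibleP=> indA [k kA] [i iA]; rewrite /proper_subsemigroup set_b_subsemigroup // andbT.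
rewrite properE set_b_OD /=; apply/subsetPn; exists (corank1 k i false).
  exact: corank1_OD.
by rewrite corank1_set_b negb_or kA.
Qed.

Lemma set_b_subset A B : admissible B -> (set_b A \subset set_b B) = (A \subset B).
Proof.
case/admissibleP=> _ [k kB] [i iB]; apply/idP/idP => [sAB|sAB].
  apply/subsetP=> x; case/boolP: (odd x) => [/kerv_surj|/missv_surj] [z ->] zA.
    have := subsetP sAB (corank1 z i false); rewrite !corank1_set_b zA (negbTE iB) orbF.
    exact.
  have := subsetP sAB (corank1 k z false); rewrite !corank1_set_b zA (negbTE kB) orbT /=.
  exact.
apply/subsetP=> a aA; have aO := subsetP (set_b_OD A) a aA.
have [aJ|] := boolP (a \in Jpred n); last exact: notJ_set_b.
have [k' [i' [s Ea]]] := J_corank1 aO aJ; move: aA.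
rewrite Ea !corank1_set_b => /orP[/(subsetP sAB)->|/(subsetP sAB)->] //; exact: orbT.
Qed.

Lemma gamma_set_b A : gamma n \in set_b A.
Proof. by apply: notJ_set_b; [apply: OD_gamma|apply: (flip_notJ m true)]. Qed.

Lemma gamma_neq1 : gamma n != 1%g.
Proof.
rewrite -tot_gamma -tot1; apply/eqP => /tot_inj/(_ ord0)/(congr1 val) /=.
by rewrite subn1.
Qed.

Lemma set_a_maximal : maximal_subsemigroup (OD n) (set_a n).
Proof.
apply/maxsetP; split.
  rewrite /proper_subsemigroup properD1 ?OD_gamma //=.
  apply/subsemigroupP=> a b; rewrite !in_setD1 => /andP[ag aO] /andP[bg bO].
  rewrite OD_mul // andbT; apply: contra_neq gamma_neq1 => E.
  have ra : rank a = n.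
    apply/eqP; rewrite eqn_leq rank_le /= -{1}(rank_gamma n) -E; exact: rank_mull.
  have rb : rank b = n.
    apply/eqP; rewrite eqn_leq rank_le /= -{1}(rank_gamma n) -E; exact: rank_mulr.
  have [s Ea] := rank_full_flip aO ra; have [t Eb] := rank_full_flip bO rb.
  move: ag bg E; rewrite Ea Eb; case: s t {Ea Eb} => [] [] /=; rewrite ?eqxx // => _ _ <-.
  by rewrite mulg1.
move=> N /andP[/properP[NO [x xO xN]] _] aN; apply/eqP; rewrite eqEsubset aN andbT.
apply/subsetP=> y yN; rewrite in_setD1 (subsetP NO) // andbT.
apply: contraNneq xN => yg; have [->|xg] := eqVneq x (gamma n); first by rewrite -yg.
by apply: (subsetP aN); rewrite in_setD1 xg.
Qed.

(** A proper subsemigroup that contains [gamma n] lies in [set_b A] for an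
    admissible [A]. For some kernel pair [k] and missed point [i] it contains
    neither of the elements with these data: otherwise, at the end of the folded
    path that is fixed by the reflection, it would contain elements of both
    orientations, and multiplying by them would give all elements of rank n - 1.
    Read membership in [M] as arrows from kernel pairs to missed points, and
    transversality as arrows back; [A] consists of the missed points reachable
    from [k] and the kernel pairs not reachable from it. *)
Lemma cover_subsemigroup M : proper_subsemigroup (OD n) M -> gamma n \in M ->
  exists2 A, admissible A & M \subset set_b A.
Proof.
case/andP=> /properP[MO [x xO xM]] /subsemigroupP Mm Mg.
have Mf s : flip n s \in M by case: s => //=; rewrite -gammaK Mm.
pose T k i := [exists s, corank1 k i s \in M].
have Tl s k i : T (revb s k) i = T k i.
  apply/existsP/existsP => -[t]; last first.
    by move=> /(Mm _ _ (Mf s)); rewrite flip_corank1; exists (t (+) s).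
  by move=> /(Mm _ _ (Mf s)); rewrite flip_corank1 revbD addbb; exists (t (+) s).
have Tr s k i : T k (revb s i) = T k i.
  apply/existsP/existsP => -[t]; last first.
    by move=> /Mm/(_ (Mf s)); rewrite corank1_flip; exists (t (+) s).
  by move=> /Mm/(_ (Mf s)); rewrite corank1_flip revbD addbb; exists (t (+) s).
have TM k i l j : T k i -> transv i l -> T l j -> T k j.
  case/existsP=> s kis il /existsP[t ljt]; apply/existsP; exists (s (+) t).
  by rewrite -(corank1_mul _ _ _ _ il) Mm.
have [/forallP Tall|] := boolP [forall k, forall i, T k i].
  suff /subsetP/(_ _ xO) : OD n \subset M by rewrite (negbTE xM).
  have {}Tall k i : T k i by have /forallP := Tall k.
  apply: OD_gen => // k i s; have [om|om] := boolP (odd m).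
    (* For odd n the middle point is fixed by the reversal. *)
    have cn : m.+1./2 < n by lia.
    have cn' : m.+1./2 < m.+1 by lia.
    pose c := Ordinal cn; pose d := Ordinal cn'.
    have cr : rev_ord c = c by apply: val_inj => /=; lia.
    have /existsP[u ku] := Tall k c; have /existsP[v dv] := Tall d i.
    have cd : transv c d by rewrite /transv eqxx.
    have := Mm _ _ ku dv; rewrite corank1_mul //.
    have := Mm _ _ (Mm _ _ ku Mg) dv.
    rewrite -[gamma n]/(flip n true) corank1_flip /= cr corank1_mul //.
    by case: u v s {ku dv} => [] [] [].
  (* For even n the middle kernel pair is fixed by the reversal. *)
  have cn : m./2 < n by lia.
  have cn' : m./2 < m.+1 by lia.
  pose c := Ordinal cn; pose d := Ordinal cn'.
  have dr : rev_ord d = d by apply: val_inj => /=; lia.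
  have /existsP[u ku] := Tall k c; have /existsP[v dv] := Tall d i.
  have cd : transv c d by rewrite /transv eqxx.
  have := Mm _ _ ku dv; rewrite corank1_mul //.
  have := Mm _ _ ku (Mm _ _ Mg dv).
  rewrite -[gamma n]/(flip n true) flip_corank1 /= dr corank1_mul //.
  by case: u v s {ku dv} => [] [] [].
rewrite negb_forall => /existsP[k]; rewrite negb_forall => /existsP[i kiM].
pose B := [set missv j | j in [set j | T k j]].
have Bcol j : (missv j \in B) = T k j.
  apply/imsetP/idP => [[j']|kj]; last by exists j; rewrite // inE.
  by rewrite inE => kj' /missv_eq[s ->]; rewrite Tr.
have Beven y : y \in B -> ~~ odd y by case/imsetP=> j _ ->; rewrite missv_even.
pose A := B :|: [set x : 'I_n |
  [&& odd x, x != kerv k & [forall y in B, ~~ path_graph y x]]].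
have Acol j : (missv j \in A) = T k j by rewrite !inE missv_even orbF Bcol.
have Arow l : (kerv l \in A) = (kerv l != kerv k) && [forall y in B, ~~ path_graph y (kerv l)].
  rewrite !inE kerv_odd /=; case: (boolP (_ \in B)) => // /Beven; by rewrite kerv_odd.
exists A.
  apply/admissibleP; split; last 2 first.
  - by exists k; rewrite Arow eqxx.
  - by exists i; rewrite Acol.
  apply/independentP=> y z; case/boolP: (odd y) => [/kerv_surj|/missv_surj] [p ->];
   case/boolP: (odd z) => [/kerv_surj|/missv_surj] [q ->].
  - by move=> _ _; rewrite /path_graph /num; move: (kerv_odd p) (kerv_odd q); lia.
  - rewrite Arow Acol -Bcol => /andP[_ /'forall_implyP H] /H.
    by rewrite path_graph_sym.
  - by rewrite Arow Acol -Bcol => + /andP[_ /'forall_implyP H] => /H.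
  - by move=> _ _; rewrite /path_graph /num; move: (missv_even p) (missv_even q); lia.
apply/subsetP=> a aM; have aO := subsetP MO a aM.
have [aJ|] := boolP (a \in Jpred n); last exact: notJ_set_b.
have [l [j [s Ea]]] := J_corank1 aO aJ; move: aM; rewrite Ea corank1_set_b => aM.
have lj : T l j by apply/existsP; exists s.
rewrite Arow Acol; case: eqP => [/kerv_eq[t lk]|_] /=.
  by rewrite -(Tl t) -lk.
case: (boolP [forall y in B, _]) => //=; rewrite negb_forall_in => /exists_inP[y yB].
rewrite negbK; move/imsetP: yB => [p + ->]; rewrite inE => kp /path_transv[t tp].
by apply: TM tp lj; rewrite Tr.
Qed.

(** For n = 2 only the empty set is admissible. *)
Theorem maximal_subsemigroupE M : maximal_subsemigroup (OD n) M <->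
  M = set_a n \/ exists2 A, maxset (@admissible n) A & M = set_b A.
Proof.
have only A B : maxset (@admissible n) A -> admissible B ->
    set_b A \subset set_b B -> A = B.
  move=> /maxsetP[_ maxA] adB; rewrite set_b_subset // => AB.
  by rewrite (maxA B).
have toA N : maximal_subsemigroup (OD n) N -> gamma n \in N ->
    exists2 A, maxset (@admissible n) A & N = set_b A.
  move=> /maxsetP[Np maxN] gN; have [A adA NA] := cover_subsemigroup Np gN.
  have EN := maxN _ (set_b_proper adA) NA; exists A; last by [].
  apply/maxsetP; split=> // B adB AB.
  have AB' : set_b A \subset set_b B by rewrite set_b_subset.
  have EB : set_b B = N by apply: maxN; [apply: set_b_proper | rewrite -EN].
  by apply/eqP; rewrite eqEsubset AB andbT -(set_b_subset _ adA) EB -EN.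
split=> [maxM|[->|[A maxA ->]]]; last 2 first.
- exact: set_a_maximal.
- have [adA _] := maxsetP maxA.
  have [N maxN AN] := maxset_exists (set_b_proper adA).
  have gN : gamma n \in N by apply: (subsetP AN); apply: gamma_set_b.
  have [B maxB EN] := toA N maxN gN.
  rewrite (only A B) -?EN //; by case/maxsetP: maxB.
have [gM|gM] := boolP (gamma n \in M); first by right; apply: toA.
left; have [Mp maxM'] := maxsetP maxM; have [ap _] := maxsetP set_a_maximal.
rewrite (maxM' (set_a n)) //; apply/subsetP=> a aM; rewrite in_setD1.
have /andP[/properP[MO _] _] := Mp; rewrite (subsetP MO) // andbT.
by apply: contraNneq gM => <-.
Qed.

End Maximal.

(** * Maximal admissible sets of vertices *)

Lemma maximal_independentP (V : finType) (e : rel V) (A : {set V}) :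
  symmetric e -> irreflexive e ->
  reflect (forall x, (x \in A) = [forall y in A, ~~ e x y]) (maximal_independent e A).
Proof.
move=> es ei; apply: (iffP maxsetP) => [[indA maxA] x|H].
  move/independentP in indA.
  apply/idP/'forall_implyP => [xA y yA|H]; first exact: indA.
  rewrite -(maxA (x |: A)) ?setU11 ?subsetUr //.
  apply/independentP=> y z; rewrite !in_setU1.
  case/predU1P=> [->|yA] /predU1P[->|zA]; rewrite ?ei //; first exact: H.
    by rewrite es H.
  exact: indA.
split=> [|B /independentP indB AB].
  by apply/independentP=> x y xA yA; move: xA; rewrite H => /'forall_implyP; apply.
apply/eqP; rewrite eqEsubset AB andbT; apply/subsetP=> x xB; rewrite H.
by apply/'forall_implyP=> y yA; apply: indB => //; apply: (subsetP AB).
Qed.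

Lemma neq_bool (b c : bool) : b != c -> ~~ b = c.
Proof. by case: b c => [] []. Qed.

Section Path.
Variable m : nat.
Local Notation n := m.+2.
Implicit Types (x y v w : 'I_n) (A B : {set 'I_n}).

Lemma path_parity x y : path_graph x y -> odd y = ~~ odd x.
Proof. by rewrite /path_graph /num; lia. Qed.

Lemma path_nbr x : exists y, path_graph x y.
Proof.
have [E|x0] := eqVneq (x : nat) 0.
  by exists (inord 1); rewrite /path_graph /num inordK // E.
exists (inord x.-1); rewrite /path_graph /num inordK; move: (ltn_ord x); lia.
Qed.

(** The vertices of the same parity as [v], without [v]. *)
Definition class_but v := [set x : 'I_n | odd x == odd v] :\ v.

Lemma in_class_but v x : (x \in class_but v) = (x != v) && (odd x == odd v).
Proof. by rewrite !inE. Qed.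

(** [A] omits some vertex of parity [c]. *)
Definition misses A (c : bool) := [exists x : 'I_n, (odd x == c) && (x \notin A)].

Lemma admissibleE A :
  admissible A = independent (@path_graph n) A && [forall c, misses A c].
Proof.
rewrite /admissible; congr (_ && _); apply/andP/forallP => [[H1 H2] c|H].
  by case: c; [move: H1|move: H2]; congr (is_true _); apply: eq_existsb => x; case: odd.
by split; [have := H true|have := H false]; congr (is_true _); apply: eq_existsb => x; case: odd.
Qed.

Lemma maximal_both_admissible A : maximal_independent (@path_graph n) A ->
  (forall c, exists2 x, x \in A & odd x = c) -> maxset (@admissible n) A.
Proof.
move=> /maxsetP[indA maxA] both; apply/maxsetP; split; last first.
  by move=> B; rewrite admissibleE => /andP[indB _]; apply: maxA.
rewrite admissibleE indA; apply/forallP=> c; have [x xA xc] := both (~~ c).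
have [y xy] := path_nbr x; apply/existsP; exists y.
rewrite (path_parity xy) xc negbK eqxx /=.
by apply: contraL xy => yA; move/independentP: indA; apply.
Qed.

(** A vertex of the other parity has a neighbour different from [v] unless it is
    an end of the path adjacent to [v]; this is excluded by the two hypotheses,
    so no such vertex can be added. *)
Lemma class_but_admissible v : v != 1 :> nat -> v != m :> nat ->
  maxset (@admissible n) (class_but v).
Proof.
move=> v1 vm; apply/maxsetP; split.
  rewrite admissibleE; apply/andP; split.
    apply/independentP=> x y; rewrite !in_class_but => /andP[_ /eqP xv] /andP[_ /eqP yv].
    by apply/negP=> /path_parity; rewrite xv yv; case: odd.
  apply/forallP=> c; have [->|cv] := eqVneq c (odd v).
    by apply/existsP; exists v; rewrite in_class_but !eqxx.
  have [y vy] := path_nbr v; apply/existsP; exists y.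
  rewrite in_class_but (path_parity vy); by case: c (odd v) cv => [] [] //= _; rewrite andbF.
move=> B; rewrite admissibleE => /andP[/independentP indB /forallP missB] vB.
apply/eqP; rewrite eqEsubset vB andbT; apply/subsetP=> w wB; rewrite in_class_but.
have vNB : v \notin B.
  have /existsP[x /andP[/eqP xv xB]] := missB (odd v).
  apply: contra xB => vB'; have [->//|xnv] := eqVneq x v.
  by apply: (subsetP vB); rewrite in_class_but xnv xv eqxx.
have -> /= : w != v by apply: contraNneq vNB => <-.
apply: contraT => wv.
(* A neighbour u of w different from v, which belongs to the set. *)
have [u uv wu] : exists2 u : 'I_n, u != v & path_graph w u.
  have [E|w0] := eqVneq (w : nat) 0.
    exists (inord 1); last by rewrite /path_graph /num inordK // E.
    by rewrite -val_eqE /= inordK // eq_sym.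
  have [E|wm] := eqVneq (w : nat) m.+1.
    exists (inord m); last by rewrite /path_graph /num inordK // E eqxx orbT.
    by rewrite -val_eqE /= inordK // eq_sym.
  have lw := ltn_ord w.
  have [E|vw] := eqVneq (v : nat) w.+1.
    exists (inord w.-1); rewrite -?val_eqE /path_graph /num /= inordK; lia.
  by exists (inord w.+1); rewrite -?val_eqE /path_graph /num /= inordK; lia.
have uB : u \in B.
  apply: (subsetP vB); rewrite in_class_but uv (path_parity wu).
  by rewrite (neq_bool wv) eqxx.
by move: (indB _ _ wB uB); rewrite wu.
Qed.

(** Suppose [A] is maximal admissible but not maximal independent, and that [v]
    can be added keeping [A] independent. Then the larger set contains all
    vertices of one parity, hence no vertex of the other parity. *)
Lemma maxset_admissibleP A : 1 <= m -> reflect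
  ((maximal_independent (@path_graph n) A /\ forall c, exists2 x, x \in A & odd x = c)
   \/ exists v, [/\ v != 1 :> nat, v != m :> nat & A = class_but v])
  (maxset (@admissible n) A).
Proof.
move=> m1; apply: (iffP idP) => [/maxsetP[]|[[]|[v [v1 vm ->]]]]; last 2 first.
- exact: maximal_both_admissible.
- exact: class_but_admissible.
rewrite admissibleE => /andP[indA /forallP missA] maxA.
have pgs := @path_graph_sym n; have pgi := @path_graph_irr n.
have [maxiA|] := boolP (maximal_independent (@path_graph n) A).
  left; split=> // c; have /existsP[x /andP[/eqP xc xA]] := missA (~~ c).
  move/(maximal_independentP _ pgs pgi): (maxiA) => /(_ x); rewrite (negbTE xA).
  move/esym/negbT; rewrite negb_forall_in => /exists_inP[y yA].
  by rewrite negbK => /path_parity; rewrite xc negbK; exists y.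
have indU v : v \notin A -> (forall y, y \in A -> ~~ path_graph v y) ->
    independent (@path_graph n) (v |: A).
  move=> vA H; apply/independentP=> y z; rewrite !in_setU1.
  case/predU1P=> [->|yA] /predU1P[->|zA]; rewrite ?pgi //; first exact: H.
    by rewrite pgs H.
  by move/independentP: indA; apply.
move=> nmax; right.
have [v vA Hv] : exists2 v, v \notin A & forall y, y \in A -> ~~ path_graph v y.
  suff /exists_inP[v vA /forall_inP Hv] :
      [exists v in ~: A, [forall y in A, ~~ path_graph v y]].
    by exists v; rewrite // -in_setC.
  apply: contraR nmax; rewrite negb_exists_in => /forall_inP H.
  apply/(maximal_independentP _ pgs pgi) => x; have [xA|xA] := boolP (x \in A).
    by symmetry; apply/forall_inP=> y yA; move/independentP: indA; apply.
  by symmetry; apply/negbTE/H; rewrite in_setC.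
have iU := indU v vA Hv.
have nU : ~~ admissible (v |: A).
  by apply: contra vA => /maxA; rewrite subsetUr => /(_ isT) <-; rewrite setU11.
have [c Hc] : exists c, ~~ misses (v |: A) c.
  by apply/existsP; rewrite -negb_forall; move: nU; rewrite admissibleE iU.
have inU x : odd x = c -> x \in v |: A.
  by move=> xc; apply: contraR Hc => xU; apply/existsP; exists x; rewrite xc eqxx.
have vc : odd v = c.
  have /existsP[x /andP[/eqP xc xA]] := missA c.
  by move: (inU x xc); rewrite in_setU1 (negbTE xA) orbF => /eqP <-.
have EA : A = class_but v.
  apply/setP=> x; rewrite in_class_but vc; apply/idP/andP => [xA|[xv /eqP /inU]].
    split; first by apply: contraNneq vA => <-.
    apply: contraT => xc; have [y xy] := path_nbr x.
    have yU : y \in v |: A by apply: inU; rewrite (path_parity xy) (neq_bool xc).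
    have xU : x \in v |: A by rewrite in_setU1 xA orbT.
    by move/independentP: iU => /(_ _ _ xU yU); rewrite xy.
  by rewrite in_setU1 (negbTE xv).
(* An end w with v as its only neighbour could be added to A; the vertex u
   shows that the other parity is still not exhausted. *)
have leaf w (u : 'I_n) : (forall y, path_graph w y -> y = v) ->
    odd w != c -> odd u != c -> u != w -> False.
  move=> wv wc uc uw.
  have wA : w \notin A by rewrite EA in_class_but vc (negbTE wc) andbF.
  suff adw : admissible (w |: A).
    by move: wA; rewrite -(maxA _ adw) ?subsetUr // setU11.
  rewrite admissibleE indU //=; last first.
    by move=> y yA; apply: contraL yA => /wv->.
  apply/forallP=> d; have [->|dc] := eqVneq d c; apply/existsP.
    exists v; rewrite in_setU1 (negbTE vA) vc eqxx orbF /=.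
    by apply: contraNneq wc => <-; rewrite vc.
  exists u; rewrite in_setU1 (negbTE uw) EA in_class_but vc (negbTE uc) andbF.
  by rewrite andbT; move: dc; rewrite -(neq_bool uc) => /neq_bool/negb_inj->.
exists v; split=> //; apply/eqP => Ev.
  apply: (@leaf (inord 0) (inord 2)); rewrite -?vc ?Ev -?val_eqE /= ?inordK //.
  by move=> y; rewrite /path_graph /num inordK // => H; apply: val_inj; move: H; rewrite /=; lia.
have lt2 : m.-1 < n by lia.
apply: (@leaf ord_max (inord m.-1)); rewrite -?vc ?Ev -?val_eqE /= ?inordK //; try lia.
by move=> y; rewrite /path_graph /num /= => H; apply: val_inj => /=; move: (ltn_ord y) H; lia.
Qed.
End Path.

(** * The number of maximal independent subsets of a path *)

(** The maximal independent subsets of the path graph of order [n]. *)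
Definition path_mis n := [set A : {set 'I_n} | maximal_independent (@path_graph n) A].

Lemma in_path_mis n (A : {set 'I_n}) :
  reflect (forall x, (x \in A) = [forall y in A, ~~ path_graph x y]) (A \in path_mis n).
Proof.
rewrite inE; apply: maximal_independentP; [exact: path_graph_sym | exact: path_graph_irr].
Qed.

Section Extend.
Variables (k d : nat) (h : 'I_k).
Implicit Types (A : {set 'I_d}) (B : {set 'I_(k + d)}).

(** The union of the vertex [h] of an initial path of order [k] and of the set
    [A], shifted by [k]. *)
Definition extend A : {set 'I_(k + d)} := lshift d h |: (@rshift k d) @: A.

Lemma lshift_extend A p : (lshift d p \in extend A) = (p == h).
Proof.
rewrite in_setU1 (inj_eq (@lshift_inj _ _)).
case: imsetP => [[q _ /eqP]|_]; rewrite ?orbF // -val_eqE /=.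
by move: (ltn_ord p); lia.
Qed.

Lemma rshift_extend A q : (rshift k q \in extend A) = (q \in A).
Proof.
rewrite in_setU1 (mem_imset _ _ (@rshift_inj _ _)) -val_eqE /=.
by case: eqP => //; move: (ltn_ord h); lia.
Qed.

Lemma extend_inj : injective extend.
Proof. by move=> A A' E; apply/setP=> q; rewrite -!rshift_extend E. Qed.

Lemma extend_surj B : (forall p, (lshift d p \in B) = (p == h)) ->
  B = extend [set q | rshift k q \in B].
Proof.
move=> HB; apply/setP=> x; rewrite -(splitK x); case: (split x) => [p|q] /=.
  by rewrite HB lshift_extend.
by rewrite rshift_extend inE.
Qed.

(** This holds when the single vertex [h] is a maximal independent set of the
    initial path and is not its last vertex. *)
Lemma extend_mis A : h.+1 < k -> (forall p, p != h -> path_graph p h) ->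
  (extend A \in path_mis (k + d)) = (A \in path_mis d).
Proof.
move=> hk dom; have E q : [forall y in extend A, ~~ path_graph (rshift k q) y]
    = [forall y in A, ~~ path_graph q y].
  apply/forall_inP/forall_inP => H y yA.
    have := H (rshift k y); rewrite rshift_extend /path_graph /num /= => /(_ yA).
    by lia.
  move: yA; rewrite -(splitK y); case: (split y) => [p|r] /=.
    by rewrite lshift_extend => /eqP->; rewrite /path_graph /num /=; lia.
  rewrite rshift_extend => /H; rewrite /path_graph /num /=; lia.
apply/in_path_mis/in_path_mis => [H q|H x]; first by rewrite -rshift_extend H E.
rewrite -(splitK x); case: (split x) => [p|q] /=; last by rewrite E rshift_extend.
rewrite lshift_extend; have [->|ph] := eqVneq p h; symmetry.
  apply/forall_inP=> y; rewrite -(splitK y); case: (split y) => [q|r] /=.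
    by rewrite lshift_extend => /eqP->; rewrite path_graph_irr.
  by move=> _; rewrite /path_graph /num /=; lia.
apply/negbTE; rewrite negb_forall_in; apply/exists_inP; exists (lshift d h).
  by rewrite lshift_extend.
by rewrite negbK; apply: dom.
Qed.
End Extend.

Lemma mis_dom d (A : {set 'I_d}) x : A \in path_mis d -> x \notin A ->
  exists2 y, y \in A & path_graph x y.
Proof.
move/in_path_mis/(_ x) => H; rewrite H negb_forall_in => /exists_inP[y yA].
by rewrite negbK; exists y.
Qed.

Lemma mis_indep d (A : {set 'I_d}) x y :
  A \in path_mis d -> x \in A -> path_graph x y -> y \notin A.
Proof.
move/in_path_mis/(_ x) => H; rewrite H => /forall_inP Hx; apply: contraL; exact: Hx.
Qed.

(** A maximal independent set contains exactly one of the first two vertices.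
    If it contains the first, the rest is a maximal independent set of the path
    without two vertices; if it contains the second, of the path without three. *)
Lemma card_path_mis_rec d :
  #|path_mis d.+3| = #|path_mis d.+1| + #|path_mis d|.
Proof.
pose h2 : 'I_2 := ord0; pose h3 : 'I_3 := Ordinal (isT : 1 < 3).
pose E2 := @extend 2 d.+1 h2; pose E3 := @extend 3 d h3.
have mis2 A : (E2 A \in path_mis d.+3) = (A \in path_mis d.+1).
  by apply: extend_mis => //; case=> [] [|[|]].
have mis3 A : (E3 A \in path_mis d.+3) = (A \in path_mis d).
  by apply: extend_mis => //; case=> [] [|[|[|]]].
have in2 A : (ord0 : 'I_d.+3) \in E2 A.
  have -> : ord0 = lshift d.+1 h2 :> 'I_d.+3 by apply: val_inj.
  exact: etrans (lshift_extend h2 A h2) (eqxx _).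
have in3 A : (ord0 : 'I_d.+3) \notin E3 A.
  have -> : ord0 = lshift d (ord0 : 'I_3) :> 'I_d.+3 by apply: val_inj.
  by apply/negbT; apply: (lshift_extend h3 A ord0).
have -> : path_mis d.+3 = E2 @: path_mis d.+1 :|: E3 @: path_mis d.
  apply/setP=> B; rewrite in_setU; apply/idP/orP => [BM|[] /imsetP[A AM ->]]; last 2 first.
  - by rewrite mis2.
  - by rewrite mis3.
  have [B0|B0] := boolP ((ord0 : 'I_d.+3) \in B).
    have EB : B = E2 [set q | rshift 2 q \in B].
      apply: (@extend_surj 2) => p; have [->|ph] := eqVneq p h2.
        by rewrite -[RHS]B0; congr (_ \in B); apply: (@ord_inj d.+3).
      apply: negbTE; apply: (@mis_indep d.+3 B ord0 (lshift d.+1 p)) => //.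
      by case: p ph => [] [|[|]].
    by left; rewrite EB; apply: imset_f; rewrite -mis2 -EB.
  have B1 : (inord 1 : 'I_d.+3) \in B.
    have [y yB y0] := mis_dom BM B0; rewrite (_ : inord 1 = y) //.
    by apply: val_inj; move: y0; rewrite /path_graph /num /= inordK //=; lia.
  have EB : B = E3 [set q | rshift 3 q \in B].
    apply: (@extend_surj 3) => p; have [->|ph] := eqVneq p h3.
      by rewrite -[RHS]B1; congr (_ \in B); apply: (@ord_inj d.+3); rewrite /= inordK.
    apply: negbTE; apply: (@mis_indep d.+3 B (inord 1) (lshift d p)) => //.
    by case: p ph => [] [|[|[|]]] // H _; rewrite /path_graph /num /= inordK.
  by right; rewrite EB; apply: imset_f; rewrite -mis3 -EB.
rewrite cardsU (card_imset _ (@extend_inj 2 d.+1 h2)) (card_imset _ (@extend_inj 3 d h3)).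
rewrite (_ : _ :&: _ = set0) ?cards0 ?subn0 //.
apply/setP=> B; rewrite in_setI in_set0; apply/negP => /andP[/imsetP[A _ ->] /imsetP[A' _ E]].
by move: (in2 A) (in3 A'); rewrite E => ->.
Qed.

Lemma card_path_mis0 : #|path_mis 0| = 1.
Proof.
have -> : path_mis 0 = powerset setT.
  by apply/setP=> A; rewrite powersetT in_setT; apply/in_path_mis; case.
by rewrite card_powerset cardsT card_ord.
Qed.

Lemma card_path_mis1 : #|path_mis 1| = 1.
Proof.
rewrite (_ : path_mis 1 = [set setT]) ?cards1 //; apply/setP=> A; rewrite in_set1.
apply/in_path_mis/eqP => [H|->]; last first.
  by move=> x; rewrite in_setT; symmetry; apply/forall_inP=> y _; rewrite /path_graph !ord1.
apply/setP=> x; rewrite H in_setT; apply/forall_inP=> y _; by rewrite /path_graph !ord1.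
Qed.

Lemma card_path_mis2 : #|path_mis 2| = 2.
Proof.
rewrite (_ : path_mis 2 = [set [set ord0]; [set ord_max]]); last first.
  have pE (x y : 'I_2) : path_graph x y = (x != y).
    by case: x y => [] [|[|]] // hx [] [|[|]].
  apply/setP=> A; rewrite in_set2; apply/in_path_mis/orP => [H|].
    have [A0|A0] := boolP (ord0 \in A); [left|right]; apply/eqP/setP=> x; rewrite in_set1.
      apply/idP/eqP => [|->//]; rewrite H => /forall_inP/(_ _ A0); by rewrite pE negbK => /eqP.
    have A1 : ord_max \in A.
      move: (A0); rewrite H negb_forall_in => /exists_inP[y yA].
      rewrite pE negbK => y0; rewrite (_ : ord_max = y) //.
      by apply: val_inj; case: y y0 {yA} => [] [|[|]].
    apply/idP/eqP => [|->//]; rewrite H => /forall_inP/(_ _ A1); by rewrite pE negbK => /eqP.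
  by case=> /eqP-> x; rewrite in_set1; apply/eqP/forall_inP => [-> y|H];
    rewrite ?in_set1 ?pE ?negbK => //; [move/eqP->|have := H _ (set11 _); rewrite pE negbK => /eqP|
    move/eqP->|have := H _ (set11 _); rewrite pE negbK => /eqP].
by rewrite cards2; case: eqP => // /setP/(_ ord0); rewrite !inE.
Qed.

(** At order 0 the count is 1, which differs from the unused value [Aseq 0]. *)
Lemma card_path_mis d : 0 < d -> #|path_mis d| = Aseq d.
Proof.
elim/ltn_ind: d => -[|[|[|[|d]]]] // IH _; rewrite ?card_path_mis1 ?card_path_mis2 //.
  by rewrite card_path_mis_rec card_path_mis1 card_path_mis0.
by rewrite card_path_mis_rec (IH d.+2) ?(IH d.+1) //; lia.
Qed.

(** * Green's relations and the types *)

Section Green.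
Local Open Scope group_scope.
Variables (T : finMonoidType) (S : {set T}).
Hypotheses (S1 : 1 \in S) (SM : forall a b, a \in S -> b \in S -> a * b \in S).
Implicit Types a b u v : T.

Lemma greenLP a b :
  reflect ((exists2 u, u \in S & b = u * a) /\ (exists2 u, u \in S & a = u * b))
          (greenL S a b).
Proof.
apply: (iffP eqP) => [E|[[u uS Eb] [v vS Ea]]].
  have aL : a \in lideal S a by apply/imsetP; exists 1; rewrite ?mul1g.
  have bL : b \in lideal S b by apply/imsetP; exists 1; rewrite ?mul1g.
  by split; apply/imsetP; [move: bL; rewrite -E|move: aL; rewrite E].
apply/setP=> x; apply/imsetP/imsetP => -[w wS ->].
  by exists (w * v); rewrite ?SM // -mulgA -Ea.
by exists (w * u); rewrite ?SM // -mulgA -Eb.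
Qed.

Lemma greenRP a b :
  reflect ((exists2 u, u \in S & b = a * u) /\ (exists2 u, u \in S & a = b * u))
          (greenR S a b).
Proof.
apply: (iffP eqP) => [E|[[u uS Eb] [v vS Ea]]].
  have aL : a \in rideal S a by apply/imsetP; exists 1; rewrite ?mulg1.
  have bL : b \in rideal S b by apply/imsetP; exists 1; rewrite ?mulg1.
  by split; apply/imsetP; [move: bL; rewrite -E|move: aL; rewrite E].
apply/setP=> x; apply/imsetP/imsetP => -[w wS ->].
  by exists (v * w); rewrite ?SM // mulgA -Ea.
by exists (u * w); rewrite ?SM // mulgA -Eb.
Qed.

Lemma greenJP a b :
  reflect ((exists u v, [/\ u \in S, v \in S & b = u * a * v]) /\
           (exists u v, [/\ u \in S, v \in S & a = u * b * v]))
          (greenJ S a b).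
Proof.
apply: (iffP eqP) => [E|[[u [v [uS vS Eb]]] [u' [v' [uS' vS' Ea]]]]].
  have aI : a \in ideal S a by apply/imset2P; exists 1 1; rewrite ?mul1g ?mulg1.
  have bI : b \in ideal S b by apply/imset2P; exists 1 1; rewrite ?mul1g ?mulg1.
  by split; [move: bI; rewrite -E|move: aI; rewrite E] => /imset2P[u v uS vS Ex]; exists u, v.
apply/setP=> x; apply/imset2P/imset2P => -[w t wS tS ->].
  by exists (w * u') (v' * t); rewrite ?SM // {1}Ea !mulgA.
by exists (w * u) (v * t); rewrite ?SM // {1}Eb !mulgA.
Qed.
End Green.

Section Types.
Variable m : nat.
Local Notation n := m.+2.
Implicit Types (a b : PT n) (i j : 'I_n) (k l : 'I_m.+1) (s t : bool) (A : {set 'I_n}).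

Let O1 := @OD_1 n.
Let OM := @OD_mul n.

Lemma transv_ex i : exists k, transv i k.
Proof.
have [E|i0] := eqVneq (i : nat) 0; first by exists ord0; rewrite /transv E.
exists (inord i.-1); rewrite /transv inordK; move: (ltn_ord i); lia.
Qed.

Lemma kernel_transv_ex k : exists i, transv i k.
Proof. by exists (inord k); rewrite /transv inordK ?eqxx //; move: (ltn_ord k); lia. Qed.

(** The L-class of an element of rank n - 1 is determined by the missed point. *)
Lemma greenL_corank1 k i s l j t : greenL (OD n) (corank1 k i s) (corank1 l j t) = (i == j).
Proof.
have half k' i' s' l' j' t' u : corank1 l' j' t' = (u * corank1 k' i' s')%g -> i' = j'.
  move=> E; apply/eqP; apply: contraT => ij.
  have : i' \in im (corank1 l' j' t') by rewrite im_corank1 !inE.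
  rewrite E inE => /existsP[x]; rewrite ffunE; case: (u x) => // y /= /eqP Ey.
  have : i' \in im (corank1 k' i' s') by rewrite inE; apply/existsP; exists y; rewrite Ey.
  by rewrite im_corank1 !inE eqxx.
apply/(greenLP O1 OM)/eqP => [[[u _ /half] //]|->].
have [c ck] := kernel_transv_ex k; have [e el] := kernel_transv_ex l.
split; first by exists (corank1 l c (s (+) t)); rewrite ?corank1_OD // corank1_mul // addbAC addbb.
by exists (corank1 k e (s (+) t)); rewrite ?corank1_OD // corank1_mul // -addbA addbb addbF.
Qed.

(** The R-class of an element of rank n - 1 is determined by the kernel pair. *)
Lemma greenR_corank1 k i s l j t : greenR (OD n) (corank1 k i s) (corank1 l j t) = (k == l).
Proof.
have half k' i' s' l' j' t' u : u \in OD n ->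
    corank1 l' j' t' = (corank1 k' i' s' * u)%g -> k' = l'.
  move=> uO E; apply: val_inj => /=.
  have kk : (inord k', inord k'.+1) \in ker (corank1 k' i' s').
    by rewrite ker_corank1 -val_eqE /= /unbump !inordK; move: (ltn_ord k'); lia.
  have : (inord k', inord k'.+1) \in ker (corank1 l' j' t').
    have [f Ef] : exists f, corank1 k' i' s' = tot f by eexists; apply: corank1_fun.
    have [g Eg] : exists g, u = tot g by apply: totP; move: uO; rewrite inE => /andP[].
    by move: kk; rewrite E Ef Eg tot_mul !ker_tot /= => /eqP->.
  by rewrite ker_corank1 -val_eqE /= /unbump !inordK; move: (ltn_ord k') (ltn_ord l'); lia.
apply/(greenRP O1 OM)/eqP => [[[u uO /(half _ _ _ _ _ _ _ uO)] //]|->].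
have [c ic] := transv_ex i; have [e je] := transv_ex j.
split; first by exists (corank1 c j (s (+) t)); rewrite ?corank1_OD // corank1_mul // addbA addbb.
by exists (corank1 e i (s (+) t)); rewrite ?corank1_OD // corank1_mul // addbCA addbb addbF.
Qed.

(** The J-class from which all but one of the maximal subsemigroups arise. *)
Definition Jtop := Jpred n :&: OD n.

Lemma Jtop_corank1 k i s : corank1 k i s \in Jtop.
Proof. by rewrite inE corank1_J corank1_OD. Qed.

Lemma JtopP a : reflect (exists k i s, a = corank1 k i s) (a \in Jtop).
Proof.
apply: (iffP setIP) => [[aJ aO]|[k [i [s ->]]]]; first exact: J_corank1.
by rewrite corank1_J corank1_OD.
Qed.

Lemma Jtop_eq (U V : {set PT n}) : U \subset Jtop -> V \subset Jtop ->
  (forall k i s, (corank1 k i s \in U) = (corank1 k i s \in V)) -> U = V.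
Proof.
move=> UJ VJ UV; apply/setP=> a; have [/JtopP[k [i [s ->]]] //|aJ] := boolP (a \in Jtop).
by rewrite (contraNF (subsetP UJ a)) // (contraNF (subsetP VJ a)).
Qed.

Lemma greenJ_rank a b : greenJ (OD n) a b -> rank a = rank b.
Proof.
case/(greenJP O1 OM) => -[u [v [_ _ Eb]]] [u' [v' [_ _ Ea]]].
apply/eqP; rewrite eqn_leq; apply/andP; split; [rewrite Ea|rewrite Eb].
  exact: leq_trans (rank_mull _ _) (rank_mulr _ _).
exact: leq_trans (rank_mull _ _) (rank_mulr _ _).
Qed.

Lemma greenL_sub a b : greenL (OD n) a b -> greenJ (OD n) a b.
Proof.
case/(greenLP O1 OM) => -[u uO Eb] [v vO Ea]; apply/(greenJP O1 OM).
by split; [exists u, 1%g | exists v, 1%g]; rewrite ?mulg1.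
Qed.

Lemma greenR_sub a b : greenR (OD n) a b -> greenJ (OD n) a b.
Proof.
case/(greenRP O1 OM) => -[u uO Eb] [v vO Ea]; apply/(greenJP O1 OM).
by split; [exists 1%g, u | exists 1%g, v]; rewrite ?mul1g.
Qed.

Lemma rank_corank1 k i s : rank (corank1 k i s) = m.+1.
Proof. by apply/eqP; have := corank1_J k i s; rewrite inE. Qed.

Lemma green_class_Jtop (g : rel (PT n)) k i s :
  (forall a b, g a b -> greenJ (OD n) a b) ->
  green_class (OD n) g (corank1 k i s) \subset Jtop.
Proof.
move=> gJ; apply/subsetP=> b; rewrite !inE => /andP[-> /gJ/greenJ_rank <-].
by rewrite rank_corank1 eqxx.
Qed.

Lemma greenJ_Jtop k i s : green_class (OD n) (greenJ (OD n)) (corank1 k i s) = Jtop.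
Proof.
apply: Jtop_eq => //; first exact: green_class_Jtop.
move=> l j t; rewrite Jtop_corank1 inE corank1_OD /=; apply/(greenJP O1 OM).
have /(greenLP O1 OM)[[u uO Eu] [u' uO' Eu']] : greenL (OD n) (corank1 k i s) (corank1 l i s).
  by rewrite greenL_corank1.
have /(greenRP O1 OM)[[v vO Ev] [v' vO' Ev']] : greenR (OD n) (corank1 l i s) (corank1 l j t).
  by rewrite greenR_corank1.
split; first by exists u, v; rewrite -Eu -Ev.
by exists u', v'; rewrite -mulgA -Ev' -Eu'.
Qed.

Lemma Jtop_class : Jtop \in green_classes (OD n) (greenJ (OD n)) (OD n).
Proof.
by rewrite -(greenJ_Jtop ord0 ord0 false); apply: imset_f; apply: corank1_OD.
Qed.

Lemma Jtop_regular : regular (OD n) Jtop.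
Proof.
apply/forall_inP=> _ /JtopP[k [i [s ->]]]; have [l il] := transv_ex i.
apply/exists_inP; exists (corank1 l (inord k) s); first exact: corank1_OD.
have kk : transv (inord k : 'I_n) k by rewrite /transv inordK ?eqxx //; move: (ltn_ord k); lia.
by rewrite !corank1_mul // addbb addFb.
Qed.

(** The L-class of the elements of rank n - 1 that miss [i]. *)
Definition Lclass i := green_class (OD n) (greenL (OD n)) (corank1 ord0 i false).
(** The R-class of the elements of rank n - 1 that identify [k] and [k + 1]. *)
Definition Rclass k := green_class (OD n) (greenR (OD n)) (corank1 k ord0 false).

Lemma corank1_Lclass k i s j : (corank1 k i s \in Lclass j) = (j == i).
Proof. by rewrite inE corank1_OD greenL_corank1. Qed.
Lemma corank1_Rclass k i s l : (corank1 k i s \in Rclass l) = (l == k).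
Proof. by rewrite inE corank1_OD greenR_corank1. Qed.

(** The L-classes and the R-classes whose vertices lie in [A]. *)
Definition Lclasses A := [set Lclass i | i in [set i | missv i \in A]].
Definition Rclasses A := [set Rclass k | k in [set k | kerv k \in A]].

Lemma Lclass_inj : injective Lclass.
Proof.
by move=> i j /setP/(_ (corank1 ord0 i false)); rewrite !corank1_Lclass eqxx => /esym/eqP.
Qed.

Lemma Rclass_inj : injective Rclass.
Proof.
by move=> i j /setP/(_ (corank1 i ord0 false)); rewrite !corank1_Rclass eqxx => /esym/eqP.
Qed.

Lemma Lclasses_sub A : Lclasses A \subset green_classes (OD n) (greenL (OD n)) Jtop.
Proof. by apply/subsetP=> _ /imsetP[i _ ->]; apply: imset_f; apply: Jtop_corank1. Qed.

Lemma Rclasses_sub A : Rclasses A \subset green_classes (OD n) (greenR (OD n)) Jtop.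
Proof. by apply/subsetP=> _ /imsetP[i _ ->]; apply: imset_f; apply: Jtop_corank1. Qed.

Lemma mem_Lclasses A i : (Lclass i \in Lclasses A) = (missv i \in A).
Proof. by rewrite (mem_imset _ _ Lclass_inj) inE. Qed.

Lemma mem_Rclasses A k : (Rclass k \in Rclasses A) = (kerv k \in A).
Proof. by rewrite (mem_imset _ _ Rclass_inj) inE. Qed.

Lemma corank1_cover_L A k i s : (corank1 k i s \in cover (Lclasses A)) = (missv i \in A).
Proof.
apply/bigcupP/idP => [[_ /imsetP[j jA ->]]|iA].
  by rewrite corank1_Lclass => /eqP<-; move: jA; rewrite inE.
by exists (Lclass i); rewrite ?mem_Lclasses // corank1_Lclass.
Qed.

Lemma corank1_cover_R A k i s : (corank1 k i s \in cover (Rclasses A)) = (kerv k \in A).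
Proof.
apply/bigcupP/idP => [[_ /imsetP[j jA ->]]|iA].
  by rewrite corank1_Rclass => /eqP<-; move: jA; rewrite inE.
by exists (Rclass k); rewrite ?mem_Rclasses // corank1_Rclass.
Qed.

Lemma set_b_cover A : set_b A :&: Jtop = cover (Lclasses A) :|: cover (Rclasses A).
Proof.
apply: Jtop_eq; first exact: subsetIr.
  rewrite subUset; apply/andP; split; apply/bigcupsP=> _ /imsetP[i _ ->].
    by apply: green_class_Jtop; apply: greenL_sub.
  by apply: green_class_Jtop; apply: greenR_sub.
move=> k i s.
by rewrite in_setI corank1_set_b Jtop_corank1 andbT in_setU corank1_cover_L corank1_cover_R orbC.
Qed.

Lemma set_b_arises A : arises_from (OD n) (set_b A) Jtop.
Proof.
apply/subsetP=> a /setDP[aO aA]; rewrite inE aO andbT.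
by apply: contraNT aA; apply: notJ_set_b.
Qed.

Lemma set_b_has_type P A : P Jtop (set_b A) -> has_type (OD n) P (set_b A).
Proof.
by move=> H; exists Jtop; split; rewrite ?Jtop_class ?Jtop_regular ?set_b_arises.
Qed.

Lemma set_b_type_M2 A : admissible A -> (forall c, exists2 x, x \in A & odd x = c) ->
  type_M2 (OD n) (set_b A).
Proof.
case/admissibleP=> _ [k kA] [i iA] both; apply: set_b_has_type.
exists (Lclasses A), (Rclasses A); split; last exact: set_b_cover.
  split; last first.
    apply/properP; split; first exact: Lclasses_sub.
    exists (Lclass i); last by rewrite mem_Lclasses.
    by apply: imset_f; apply: Jtop_corank1.
  have [x xA /negbT/missv_surj[j Ex]] := both false.
  by apply/set0Pn; exists (Lclass j); rewrite mem_Lclasses -Ex.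
split; last first.
  apply/properP; split; first exact: Rclasses_sub.
  exists (Rclass k); last by rewrite mem_Rclasses.
  by apply: imset_f; apply: Jtop_corank1.
have [x xA /kerv_surj[j Ex]] := both true.
by apply/set0Pn; exists (Rclass j); rewrite mem_Rclasses -Ex.
Qed.

Lemma set_b_Jtop_neq0 A : A != set0 -> set_b A :&: Jtop != set0.
Proof.
case/set0Pn=> x; case/boolP: (odd x) => [/kerv_surj|/missv_surj] [z ->] zA; apply/set0Pn.
  by exists (corank1 z ord0 false); rewrite in_setI corank1_set_b zA Jtop_corank1.
by exists (corank1 ord0 z false); rewrite in_setI corank1_set_b zA orbT Jtop_corank1.
Qed.

Lemma set_b_type_M3 A : A != set0 -> (forall x, x \in A -> ~~ odd x) ->
  type_M3 (OD n) (set_b A).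
Proof.
move=> A0 Aev; apply: set_b_has_type; split; first exact: set_b_Jtop_neq0.
exists (Lclasses A); first exact: Lclasses_sub.
rewrite set_b_cover (_ : Rclasses A = set0) ?/cover ?big_set0 ?setU0 //.
apply/setP=> C; rewrite in_set0; apply/imsetP => -[k]; rewrite inE => /Aev.
by rewrite kerv_odd.
Qed.

Lemma set_b_type_M4 A : A != set0 -> (forall x, x \in A -> odd x) ->
  type_M4 (OD n) (set_b A).
Proof.
move=> A0 Aev; apply: set_b_has_type; split; first exact: set_b_Jtop_neq0.
exists (Rclasses A); first exact: Rclasses_sub.
rewrite set_b_cover (_ : Lclasses A = set0) ?/cover ?big_set0 ?set0U //.
apply/setP=> C; rewrite in_set0; apply/imsetP => -[k]; rewrite inE => /Aev.
by rewrite missv_even.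
Qed.

Lemma set_a_type_M5 : type_M5 (OD n) (set_a n).
Proof.
have unitL s t : greenL (OD n) (flip n s) (flip n t).
  apply/(greenLP O1 OM); split.
    by exists (flip n (t (+) s)); rewrite ?OD_flip // flipM -addbA addbb addbF.
  by exists (flip n (s (+) t)); rewrite ?OD_flip // flipM -addbA addbb addbF.
have unitR s t : greenR (OD n) (flip n s) (flip n t).
  apply/(greenRP O1 OM); split.
    by exists (flip n (s (+) t)); rewrite ?OD_flip // flipM addbA addbb.
  by exists (flip n (t (+) s)); rewrite ?OD_flip // flipM addbA addbb.
exists (green_class (OD n) (greenJ (OD n)) 1%g).
have unitP a : a \in green_class (OD n) (greenJ (OD n)) 1%g -> exists s, a = flip n s.
  by rewrite inE => /andP[aO /greenJ_rank]; rewrite rank1 => /esym; apply: rank_full_flip.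
split.
- by apply: imset_f; apply: O1.
- apply/forall_inP=> a /unitP[s ->]; apply/exists_inP; exists (flip n s).
    exact: OD_flip.
  by rewrite !flipM addbb.
- apply/subsetP=> a /setDP[aO]; rewrite in_setD1 aO andbT negbK => /eqP->.
  by rewrite inE OD_gamma; apply: greenL_sub; apply: (unitL false true).
move=> H /imsetP[a /unitP[s ->] ->]; apply/set0Pn; exists 1%g.
rewrite inE in_setD1 O1 andbT eq_sym gamma_neq1 inE O1 /=.
by rewrite /greenH (unitL s false) (unitR s false).
Qed.
End Types.

(** * The four families and their number *)

Section Families.
Variable m : nat.
Local Notation n := m.+2.
Implicit Types (i j v : 'I_n) (k l : 'I_m.+1) (s t : bool) (A B : {set 'I_n}).

(** A subset of the monoid that contains all elements of rank other than n - 1 is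
    determined by its elements of rank n - 1. *)
Lemma set_b_eq (M : {set PT n}) A : OD n :\: Jpred n \subset M -> M \subset OD n ->
  (forall k i s, (corank1 k i s \in M) = (kerv k \in A) || (missv i \in A)) -> M = set_b A.
Proof.
move=> lo hi H; apply/setP=> a; have [aO|aO] := boolP (a \in OD n); last first.
  by rewrite (contraNF (subsetP hi a)) // (contraNF (subsetP (set_b_OD A) a)).
have [aJ|aJ] := boolP (a \in Jpred n).
  by have [k [i [s ->]]] := J_corank1 aO aJ; rewrite H corank1_set_b.
by rewrite notJ_set_b // (subsetP lo) // in_setD aJ.
Qed.

Lemma set_c_class_but q v : 0 < q -> v = (q.-1).*2 :> nat ->
  set_c n q = set_b (class_but v).
Proof.
move=> q0 Ev; apply: set_b_eq; last 2 first.
- exact: subsetDl.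
- move=> k i s; rewrite in_setD corank1_OD andbT in_setU !corank1_Lset !in_class_but.
  rewrite kerv_odd missv_even -!val_eqE /=; move: (ltn_ord i) (ltn_ord v); lia.
apply: setDS; apply/subsetP=> a; rewrite in_setU => /orP[]; rewrite inE; by case/andP.
Qed.

Lemma set_d_class_but q v : 0 < q -> v = (q.-1).*2.+1 :> nat ->
  set_d n q = set_b (class_but v).
Proof.
move=> q0 Ev; apply: set_b_eq; last 2 first.
- exact: subsetDl.
- move=> k i s; rewrite in_setD corank1_OD andbT in_setU !addn1 !corank1_Rset !in_class_but.
  rewrite kerv_odd missv_even -!val_eqE /=; move: (ltn_ord k) (ltn_ord v); lia.
apply: setDS; apply/subsetP=> a; rewrite in_setU => /orP[]; rewrite inE; by case/andP.
Qed.

Lemma index_bP A : index_b A <->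
  maximal_independent (@path_graph n) A /\ forall c, exists2 x, x \in A & odd x = c.
Proof.
split=> [[Am [x xA xo] [y yA yo]]|[Am both]].
  split=> // -[]; first by exists y; rewrite // -[odd y]negbK.
  by exists x; rewrite // -[odd x]negbK; apply: negbF.
have [x xA xo] := both false; have [y yA yo] := both true.
by split=> //; [exists x; rewrite // /num /= xo|exists y; rewrite // /num /= yo].
Qed.

Lemma class_but_neq0 v : v != 1 :> nat -> 0 < m -> class_but v != set0.
Proof.
move=> v1 m1; apply/set0Pn; have [ov|ov] := boolP (odd v).
  exists (inord 1); rewrite in_class_but -val_eqE /= inordK // ov.
  by rewrite eq_sym v1.
have [v0|v0] := eqVneq (v : nat) 0.
  exists (inord 2); rewrite in_class_but -val_eqE /= inordK //; move: ov; lia.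
exists ord0; rewrite in_class_but -val_eqE /=; move: ov; lia.
Qed.

(** The indices of the family (c) are the vertices with odd number other than
    those adjacent to an end of the path. *)
Lemma index_c_vertex q : index_c n q <->
  0 < q /\ exists v, [/\ v != 1 :> nat, v != m :> nat & v = (q.-1).*2 :> nat].
Proof.
rewrite /index_c; split=> [|[q0 [v [v1 vm Ev]]]]; case: ifP => on.
- move=> H; have lt : (q.-1).*2 < n by lia.
  by split; last (exists (Ordinal lt)); rewrite /=; [lia|split=> //; lia].
- move=> H; have lt : (q.-1).*2 < n by lia.
  by split; last (exists (Ordinal lt)); rewrite /=; [lia|split=> //; lia].
- by move: (ltn_ord v); lia.
- by move: (ltn_ord v); lia.
Qed.

(** The indices of the family (d) are the vertices with even number other than
    those adjacent to an end of the path. *)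
Lemma index_d_vertex q : index_d n q <->
  0 < q /\ exists v, [/\ v != 1 :> nat, v != m :> nat & v = (q.-1).*2.+1 :> nat].
Proof.
rewrite /index_d; split=> [|[q0 [v [v1 vm Ev]]]]; case: ifP => on.
- move=> H; have lt : (q.-1).*2.+1 < n by lia.
  by split; last (exists (Ordinal lt)); rewrite /=; [lia|split=> //; lia].
- move=> H; have lt : (q.-1).*2.+1 < n by lia.
  by split; last (exists (Ordinal lt)); rewrite /=; [lia|split=> //; lia].
- by move: (ltn_ord v); lia.
- by move: (ltn_ord v); lia.
Qed.

Lemma maximal_subsemigroup_families (M : {set PT n}) : 0 < m ->
  maximal_subsemigroup (OD n) M <->
  [\/ M = set_a n, exists2 A, index_b A & M = set_b A,
      exists2 q, index_c n q & M = set_c n q |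
      exists2 q, index_d n q & M = set_d n q].
Proof.
move=> m0; rewrite maximal_subsemigroupE; split.
  case=> [->|[A /(maxset_admissibleP _ m0)[/index_bP bA|[v [v1 vm EA]]] ->]].
  - by constructor 1.
  - by constructor 2; exists A.
  - rewrite EA; have [ov|ov] := boolP (odd v); [constructor 4|constructor 3].
      have Ev : v = ((v./2.+1).-1).*2.+1 :> nat by move: ov => /=; lia.
      exists v./2.+1; last by rewrite (set_d_class_but _ Ev).
      by apply/index_d_vertex; split=> //; exists v.
    have Ev : v = ((v./2.+1).-1).*2 :> nat by move: ov => /=; lia.
    exists v./2.+1; last by rewrite (set_c_class_but _ Ev).
    by apply/index_c_vertex; split=> //; exists v.
case=> [->|[A /index_bP bA ->]|[q /index_c_vertex[q0 [v [v1 vm Ev]]] ->]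
         |[q /index_d_vertex[q0 [v [v1 vm Ev]]] ->]]; first by left.
- by right; exists A => //; apply/(maxset_admissibleP _ m0); left.
- right; exists (class_but v); last exact: set_c_class_but.
  by apply/(maxset_admissibleP _ m0); right; exists v.
- right; exists (class_but v); last exact: set_d_class_but.
  by apply/(maxset_admissibleP _ m0); right; exists v.
Qed.

Lemma index_b_type_M2 A : index_b A -> type_M2 (OD n) (set_b A).
Proof.
case/index_bP=> Am both; apply: set_b_type_M2 => //.
by case/maxsetP: (maximal_both_admissible Am both).
Qed.

Lemma index_c_type_M3 q : 0 < m -> index_c n q -> type_M3 (OD n) (set_c n q).
Proof.
move=> m0 /index_c_vertex[q0 [v [v1 vm Ev]]]; rewrite (set_c_class_but q0 Ev).
apply: set_b_type_M3; first exact: class_but_neq0.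
by move=> x; rewrite in_class_but => /andP[_ /eqP->]; rewrite Ev odd_double.
Qed.

Lemma index_d_type_M4 q : 0 < m -> index_d n q -> type_M4 (OD n) (set_d n q).
Proof.
move=> m0 /index_d_vertex[q0 [v [v1 vm Ev]]]; rewrite (set_d_class_but q0 Ev).
apply: set_b_type_M4; first exact: class_but_neq0.
by move=> x; rewrite in_class_but => /andP[_ /eqP->]; rewrite Ev /= odd_double.
Qed.

Lemma card_maximal_subsemigroups :
  #|maximal_subsemigroups (OD n)| = #|[set A | maxset (@admissible n) A]|.+1.
Proof.
have -> : maximal_subsemigroups (OD n) =
    set_a n |: (@set_b n) @: [set A | maxset (@admissible n) A].
  apply/setP=> M; rewrite inE in_setU1.
  apply/idP/predU1P => [/maximal_subsemigroupE[->|[A Am ->]]|]; first by left.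
    by right; apply: imset_f; rewrite inE.
  move=> H; apply/maximal_subsemigroupE; case: H => [->|/imsetP[A + ->]]; first by left.
  by rewrite inE; right; exists A.
rewrite cardsU1 (_ : _ \notin _) ?add1n; last first.
  apply/imsetP => -[A _ /setP/(_ (gamma n))]; by rewrite gamma_set_b in_setD1 eqxx.
rewrite card_in_imset // => A B; rewrite !inE => /maxsetP[adA _] /maxsetP[adB _] E.
by apply/eqP; rewrite eqEsubset -(set_b_subset A adB) -(set_b_subset B adA) E subxx.
Qed.

(** The vertices of parity [c]. The two parity classes are the only maximal
    independent sets without vertices of both parities. *)
Definition parity_class c := [set x : 'I_n | odd x == c].

Lemma parity_class_mis c : parity_class c \in path_mis n.
Proof.
apply/in_path_mis=> x; rewrite inE; apply/eqP/forall_inP => [xc y|H].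
  by rewrite inE => /eqP yc; apply/negP=> /path_parity; rewrite xc yc; case: c {xc yc}.
have [y xy] := path_nbr x; apply/eqP; apply: contraT => xc.
by have := H y; rewrite inE (path_parity xy) (neq_bool xc) eqxx xy => /(_ isT).
Qed.

Lemma parity_class_neq : parity_class true != parity_class false.
Proof. by apply/eqP => /setP/(_ ord0); rewrite !inE. Qed.

Lemma path_mis_both A : A \in path_mis n ->
  (forall c, exists2 x, x \in A & odd x = c) <-> (forall c, A <> parity_class c).
Proof.
move=> Am; split=> [both c EA|H c].
  by have [x xA xc] := both (~~ c); move: xA; rewrite EA inE xc; case: c {EA xc}.
suff /exists_inP[x xA /eqP xc] : [exists x in A, odd x == c] by exists x.
apply: contra_notT (H (~~ c)); rewrite negb_exists_in => /forall_inP Ac.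
have /maxsetP[_ maxA] : maximal_independent (@path_graph n) A by move: Am; rewrite inE.
symmetry; apply: maxA.
  by have := parity_class_mis (~~ c); rewrite inE => /maxsetp.
by apply/subsetP=> x xA; rewrite inE -(neq_bool (Ac x xA)) negbK eqxx.
Qed.

Lemma card_maxset_admissible : 0 < m ->
  #|[set A | maxset (@admissible n) A]| =
  (#|path_mis n| - 2) + #|[set v : 'I_n | (v != 1 :> nat) && (v != m :> nat)]|.
Proof.
move=> m0; pose par := [set parity_class true; parity_class false].
have -> : [set A | maxset (@admissible n) A] = (path_mis n :\: par)
    :|: @class_but m @: [set v : 'I_n | (v != 1 :> nat) && (v != m :> nat)].
  apply/setP=> A; rewrite inE in_setU in_setD in_set2.
  have parP : reflect (forall c, A <> parity_class c)
      (~~ ((A == parity_class true) || (A == parity_class false))).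
    rewrite negb_or; apply: (iffP andP) => [[/eqP ? /eqP ?] []//|H].
    by split; apply/eqP.
  apply/(maxset_admissibleP _ m0)/orP => [[[Am both]|[v [v1 vm ->]]]|].
  - have Am' : A \in path_mis n by rewrite inE.
    by left; rewrite Am' andbT; apply/parP/(path_mis_both Am').
  - by right; apply: imset_f; rewrite inE v1.
  case=> [/andP[/parP np Am]|/imsetP[v + ->]].
    by left; split; [move: Am; rewrite inE|apply/(path_mis_both Am)].
  by rewrite inE => /andP[v1 vm]; right; exists v.
rewrite cardsU (_ : _ :&: _ = set0) ?cards0 ?subn0; last first.
  apply/setP=> A; rewrite in_setI in_setD in_set0; apply/negP.
  case/andP=> /andP[np Am] /imsetP[v _ EA].
  have np' c : A <> parity_class c.
    by move=> E; move: np; rewrite in_set2 E; case: c {E}; rewrite eqxx ?orbT.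
  have [x] := (path_mis_both Am).2 np' (~~ odd v).
  by rewrite EA in_class_but => /andP[_ /eqP->]; case: odd.
congr (_ + _).
  rewrite cardsD (setIidPr _) ?cards2 ?parity_class_neq //.
  by apply/subsetP=> A /set2P[] ->; apply: parity_class_mis.
apply: card_in_imset => v w; rewrite !inE => /andP[v1 vm] /andP[w1 wm] E.
have [x xv] := set0Pn _ (class_but_neq0 v1 m0).
have vw : odd v = odd w.
  have : x \in class_but w by rewrite -E.
  by move: xv; rewrite !in_class_but => /andP[_ /eqP <-] /andP[_ /eqP <-].
apply/eqP; apply: contraT => nvw; have : v \in class_but w by rewrite in_class_but nvw vw eqxx.
by rewrite -E in_class_but eqxx.
Qed.

(** For n = 3 the two excluded vertices coincide. *)
Lemma card_non_support : 0 < m ->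
  #|[set v : 'I_n | (v != 1 :> nat) && (v != m :> nat)]| = n - (m != 1).+1.
Proof.
move=> m0; rewrite (_ : [set v | _] = ~: [set inord 1; inord m]); last first.
  by apply/setP=> v; rewrite !inE negb_or -!val_eqE /= !inordK //; lia.
have := cardsC [set (inord 1 : 'I_n); inord m].
by rewrite cards2 card_ord -val_eqE /= !inordK; lia.
Qed.

Lemma card_path_mis_ge2 : 2 <= #|path_mis n|.
Proof.
have <- : #|[set parity_class true; parity_class false]| = 2.
  by rewrite cards2 parity_class_neq.
by apply: subset_leq_card; apply/subsetP=> A /set2P[] ->; apply: parity_class_mis.
Qed.

End Families.

Lemma OD2_full : OD 2 = full_transf 2.
Proof.
apply/setP=> a; apply/idP/idP => [|/totP[f ->]]; first by rewrite inE => /andP[].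
rewrite OD_tot; have E (x : 'I_2) : x = ord0 \/ x = ord_max.
  by case: x => [] [|[|//]] ?; [left|right]; apply: val_inj.
have [le|le] := leqP (f ord0) (f ord_max); apply/orP; [left|right];
  apply/'forall_'forall_implyP=> x y; case: (E x) => ->; case: (E y) => -> //= _;
  exact: ltnW.
Qed.

Lemma card_maximal_subsemigroups_OD2 : #|maximal_subsemigroups (OD 2)| = 2.
Proof.
rewrite card_maximal_subsemigroups (_ : [set A | _] = [set set0]) ?cards1 //.
have adE (A : {set 'I_2}) : admissible A -> A = set0.
  case/and3P=> _ /existsP[x /andP[ox xA]] /existsP[y /andP[oy yA]].
  apply/setP=> z; rewrite in_set0; apply/negbTE.
  have [oz|oz] := boolP (odd z).
    by rewrite (_ : z = x) //; apply: val_inj => /=; move: (ltn_ord x) (ltn_ord z); lia.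
  by rewrite (_ : z = y) //; apply: val_inj => /=; move: (ltn_ord y) (ltn_ord z); lia.
have ad0 : admissible (set0 : {set 'I_2}).
  apply/and3P; split; first by apply/independentP=> x; rewrite in_set0.
    by apply/existsP; exists ord_max; rewrite in_set0.
  by apply/existsP; exists ord0; rewrite in_set0.
apply/setP=> A; rewrite !inE; apply/maxsetP/eqP => [[/adE //]|->].
by split=> // B /adE.
Qed.

Theorem theorem3p8 :
  (forall n : nat, 3 <= n ->
    [/\ forall M : {set PT n}, maximal_subsemigroup (OD n) M <->
          [\/ M = set_a n,
              exists2 A : {set 'I_n}, index_b A & M = set_b A,
              exists2 i : nat, index_c n i & M = set_c n i |
              exists2 i : nat, index_d n i & M = set_d n i],
        type_M5 (OD n) (set_a n),
        forall A : {set 'I_n}, index_b A -> type_M2 (OD n) (set_b A),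
        forall i : nat, index_c n i -> type_M3 (OD n) (set_c n i) &
        forall i : nat, index_d n i -> type_M4 (OD n) (set_d n i)]) /\
  [/\ #|maximal_subsemigroups (OD 3)| = 3,
      forall n : nat, 4 <= n -> #|maximal_subsemigroups (OD n)| = Aseq n + n - 3,
      OD 2 = full_transf 2 &
      #|maximal_subsemigroups (OD 2)| = 2].
Proof.
split=> [[|[|[|m]]] // _|].
  split; first by move=> M; apply: maximal_subsemigroup_families.
  - exact: set_a_type_M5.
  - exact: index_b_type_M2.
  - by move=> i; apply: index_c_type_M3.
  - by move=> i; apply: index_d_type_M4.
split; [| |exact: OD2_full|exact: card_maximal_subsemigroups_OD2].
  rewrite card_maximal_subsemigroups card_maxset_admissible //.
  by rewrite card_path_mis // card_non_support.
case=> [|[|[|[|m]]]] // _; have := card_path_mis_ge2 m.+2.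
rewrite card_maximal_subsemigroups card_maxset_admissible // card_path_mis // card_non_support //.
by move: (Aseq _) => c; lia.
Qed.
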